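(* Let $1/2\le\beta\le1$ and let $f(z)=z+\sum_{n=2}^\infty a_nz^n$ belong to the class $SS_\sigma(\beta)$ of strongly bi-starlike functions of order $\beta$. Then $$|a_5|\le\frac{\beta}{9}\left(30\beta^2-21\beta+9+\frac{(38\beta^2-30\beta+7)\beta}{(\beta+1)^4}+\frac{3(7\beta-3)}{\sqrt{\beta+1}}\right).$$
   Context: $\mathbb{D}=\{z\in\mathbb{C}:|z|<1\}$. $\mathcal{A}$ is the class of analytic functions $f$ on $\mathbb{D}$ with $f(0)=0$, $f'(0)=1$. A function $f\in\mathcal{A}$ is bi-univalent if $f$ is univalent (injective) in $\mathbb{D}$ and its inverse $f^{-1}$ (defined near $0$) has a univalent analytic continuation $g$ to $\mathbb{D}$; $\sigma$ denotes the class of bi-univalent functions. For analytic functions $F,G$ on $\mathbb{D}$, $F\prec G$ means there is an analytic $w$ on $\mathbb{D}$ with $w(0)=0$, $|w(z)|<1$ and $F(z)=G(w(z))$. For $0<\beta\le1$, $SS_\sigma(\beta)$ is the class of $f\in\sigma$ such that $$\frac{zf'(z)}{f(z)}\prec\left(\frac{1+z}{1-z}\right)^\beta\quad\text{and}\quad\frac{wg'(w)}{g(w)}\prec\left(\frac{1+w}{1-w}\right)^\beta$$ in $\mathbb{D}$ (principal branch of the power, value $1$ at the origin), where $g$ is the analytic continuation of $f^{-1}$ to $\mathbb{D}$. *)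

(* Defs.v *)
From Stdlib Require Import Reals.
From Coquelicot Require Import Coquelicot.
Open Scope R_scope.

(** Functions on the unit disc are total functions [C -> C]; only their values
    at points [z] with [Cmod z < 1] are ever constrained. *)

Definition analytic_on_disc (f : C -> C) : Prop :=
  forall z0 : C, Cmod z0 < 1 ->
  exists (c : nat -> C) (r : R), 0 < r /\
    forall h : C, Cmod h < r ->
      @is_pseries C_AbsRing C_NormedModule c h (f (z0 + h)%C).

Definition univalent_on_disc (f : C -> C) : Prop :=
  analytic_on_disc f /\
  forall z1 z2 : C, Cmod z1 < 1 -> Cmod z2 < 1 -> f z1 = f z2 -> z1 = z2.

Definition class_A (f : C -> C) : Prop :=
  analytic_on_disc f /\ f (RtoC 0) = RtoC 0 /\
  @is_derive C_AbsRing C_NormedModule f (RtoC 0) (RtoC 1).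

(** For [f] injective on the disc, the last clause says that [g] coincides near
    [0] with the inverse of the restriction of [f] to the disc. *)
Definition univalent_inverse_continuation (f g : C -> C) : Prop :=
  univalent_on_disc g /\
  exists r : R, 0 < r /\
    forall w : C, Cmod w < r -> Cmod (g w) < 1 /\ f (g w) = w.

Definition bi_univalent (f : C -> C) : Prop :=
  class_A f /\ univalent_on_disc f /\
  exists g : C -> C, univalent_inverse_continuation f g.

Definition subordinate (F G : C -> C) : Prop :=
  exists w : C -> C,
    analytic_on_disc w /\ w (RtoC 0) = RtoC 0 /\
    forall z : C, Cmod z < 1 -> Cmod (w z) < 1 /\ F z = G (w z).

Definition Cexp (z : C) : C := (exp (Re z) * cos (Im z), exp (Re z) * sin (Im z)).

(** Principal argument, in [(-PI, PI]], of a nonzero complex number. *)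
Definition Carg (z : C) : R :=
  if Rle_dec 0 (Im z) then acos (Re z / Cmod z) else - acos (Re z / Cmod z).

Definition Clog (z : C) : C := (ln (Cmod z), Carg z).

Definition Cpower (z : C) (b : R) : C := Cexp (RtoC b * Clog z)%C.

(** [z f'(z) / f(z)], with its removable singularity at [0] filled in: the value
    there is [1] when [f] is in [class_A]. *)
Definition starlike_quotient (f : C -> C) (z : C) : C :=
  if Ceq_dec z (RtoC 0) then RtoC 1 else (z * C_derive f z / f z)%C.

Definition strongly_starlike_majorant (beta : R) (z : C) : C :=
  Cpower ((1 + z) / (1 - z))%C beta.

(** The continuation [g] is unique on the disc by the identity theorem, so the
    existential quantifier only names it. *)
Definition SS_sigma (beta : R) (f : C -> C) : Prop :=
  bi_univalent f /\
  exists g : C -> C,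
    univalent_inverse_continuation f g /\
    subordinate (starlike_quotient f) (strongly_starlike_majorant beta) /\
    subordinate (starlike_quotient g) (strongly_starlike_majorant beta).

(* Main.v *)
Require Import Defs.
From Stdlib Require Import Reals Lra Lia List ClassicalEpsilon.
From Coquelicot Require Import Coquelicot.
Open Scope R_scope.

(** Write [z f'(z) / f(z) = ((1 + w) / (1 - w))^beta] with a Schwarz function
    [w = c1 z + c2 z^2 + ...], and likewise for the inverse [g] with a Schwarz function
    [v = q1 z + q2 z^2 + ...]. Comparing coefficients expresses [a5] as [beta / 2] times
    a polynomial in [c1], ..., [c4] ([starlike_coefficients]). The inverse function enters
    only at low order: the coefficients of [g] up to the third give [q1 = - c1] and
    [q2 = 2 beta c1^2 - c2], and since second coefficients of Schwarz functions satisfy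
    [|c2| <= 1 - |c1|^2], adding the bounds for [c2] and [q2] yields
    [|c1|^2 <= 1 / (1 + beta)] ([bi_starlike_c1_bound]).

    What is left is an extremal problem for a single Schwarz function with restricted
    first coefficient. The inequality [schwarz_c4_le], a weighted form of Carlson's bound
    on the fourth coefficient, is applied with a weight that makes the terms containing
    [c3] and [c4] disappear. The rest depends on [c1] and [c2] alone, is largest
    when [c2] is a positive multiple of [c1^2] and [|c2| = 1 - |c1|^2], and then increases
    with [|c1|^2] ([fifth_coefficient_functional_le]). This gives
    [|a5| <= beta^2 (107 beta^2 - 21 beta + 16) / (9 (1 + beta)^2)], which lies below the
    asserted bound for all [beta] between [1/2] and [1] ([target_bound]).

    Both Schwarz inequalities come from one fact: multiplication by [w] does not increase
    the sum of squares of the first coefficients ([schwarz_contraction]). It is derived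
    from a maximum principle for sums of squared moduli, in which means over circles are
    replaced by means over the four rotations by powers of [i]; hence no contour integrals
    are needed, and of [w] and [g] only local expansions are used. Functions are described
    at each point by their Taylor polynomials with an [O] remainder, and Cauchy's estimate
    for the derivative is another consequence of the same coefficient bound. *)

(** * Taylor jets *)

Definition big_O (n : nat) (h : C -> C) : Prop :=
  exists K d : R, 0 <= K /\ 0 < d /\
    forall u : C, Cmod u < d -> Cmod (h u) <= K * Cmod u ^ n.

Fixpoint taylor (c : nat -> C) (n : nat) (u : C) : C :=
  match n with
  | O => c O
  | S m => (taylor c m u + c n * u ^ n)%C
  end.

(** The estimate is required at [u = 0] as well, so a jet also fixes the value there. *)
Definition jet (n : nat) (h : C -> C) (c : nat -> C) : Prop :=
  big_O (S n) (fun u => h u - taylor c n u)%C.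

(** Cauchy product, unfolded from the left so that it follows
    [c 0 + u * (c 1 + u * ...)]. *)
Fixpoint conv (c d : nat -> C) (k : nat) : C :=
  match k with
  | O => (c O * d O)%C
  | S m => (c O * d (S m) + conv (fun i => c (S i)) d m)%C
  end.

Lemma Cmod_minus_le (x y : C) : Cmod (x - y) <= Cmod x + Cmod y.
Proof.
  unfold Cminus. rewrite <- (Cmod_opp y). apply Cmod_triangle.
Qed.

Lemma pow_le_pow_le1 (x : R) (m n : nat) :
  0 <= x <= 1 -> (m <= n)%nat -> x ^ n <= x ^ m.
Proof.
  intros Hx Hmn. replace n with (m + (n - m))%nat by lia.
  rewrite pow_add. rewrite <- (Rmult_1_r (x ^ m)) at 2.
  apply Rmult_le_compat_l; [apply pow_le; lra|].
  rewrite <- (pow1 (n - m)). apply pow_incr. lra.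
Qed.

Lemma big_O_ext (n : nat) (h1 h2 : C -> C) :
  (forall u, h1 u = h2 u) -> big_O n h1 -> big_O n h2.
Proof.
  intros He [K [d [HK [Hd H]]]]. exists K, d. repeat split; auto.
  intros u Hu. rewrite <- He. auto.
Qed.

Lemma big_O_near (n : nat) (h1 h2 : C -> C) (r : R) :
  0 < r -> (forall u, Cmod u < r -> h1 u = h2 u) -> big_O n h1 -> big_O n h2.
Proof.
  intros Hr He [K [d [HK [Hd H]]]]. exists K, (Rmin d r). repeat split; auto.
  - apply Rmin_pos; auto.
  - intros u Hu. rewrite <- He.
    + apply H. apply Rlt_le_trans with (1 := Hu). apply Rmin_l.
    + apply Rlt_le_trans with (1 := Hu). apply Rmin_r.
Qed.

Lemma big_O_plus (n : nat) (h1 h2 : C -> C) :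
  big_O n h1 -> big_O n h2 -> big_O n (fun u => h1 u + h2 u)%C.
Proof.
  intros [K1 [d1 [HK1 [Hd1 H1]]]] [K2 [d2 [HK2 [Hd2 H2]]]].
  exists (K1 + K2), (Rmin d1 d2). split; [lra|]. split; [apply Rmin_pos; auto|].
  intros u Hu. apply Rle_trans with (1 := Cmod_triangle _ _).
  rewrite Rmult_plus_distr_r. apply Rplus_le_compat.
  - apply H1. apply Rlt_le_trans with (1 := Hu), Rmin_l.
  - apply H2. apply Rlt_le_trans with (1 := Hu), Rmin_r.
Qed.

Lemma big_O_mult (m n : nat) (h1 h2 : C -> C) :
  big_O m h1 -> big_O n h2 -> big_O (m + n) (fun u => h1 u * h2 u)%C.
Proof.
  intros [K1 [d1 [HK1 [Hd1 H1]]]] [K2 [d2 [HK2 [Hd2 H2]]]].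
  exists (K1 * K2), (Rmin d1 d2). split; [nra|]. split; [apply Rmin_pos; auto|].
  intros u Hu. rewrite Cmod_mult, pow_add.
  replace (K1 * K2 * (Cmod u ^ m * Cmod u ^ n))
    with ((K1 * Cmod u ^ m) * (K2 * Cmod u ^ n)) by ring.
  apply Rmult_le_compat; try apply Cmod_ge_0.
  - apply H1. apply Rlt_le_trans with (1 := Hu), Rmin_l.
  - apply H2. apply Rlt_le_trans with (1 := Hu), Rmin_r.
Qed.

Lemma big_O_le (m n : nat) (h : C -> C) :
  (m <= n)%nat -> big_O n h -> big_O m h.
Proof.
  intros Hmn [K [d [HK [Hd H]]]]. exists K, (Rmin d 1). split; [auto|].
  split; [apply Rmin_pos; lra|].
  intros u Hu. apply Rle_trans with (K * Cmod u ^ n).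
  - apply H. apply Rlt_le_trans with (1 := Hu), Rmin_l.
  - apply Rmult_le_compat_l; auto. apply pow_le_pow_le1; auto.
    split; [apply Cmod_ge_0|]. apply Rlt_le, Rlt_le_trans with (1 := Hu), Rmin_r.
Qed.

Lemma big_O_const (a : C) : big_O 0 (fun _ => a).
Proof.
  exists (Cmod a), 1. split; [apply Cmod_ge_0|]. split; [lra|].
  intros u _. simpl. lra.
Qed.

Lemma big_O_pow (n : nat) : big_O n (fun u => u ^ n)%C.
Proof.
  exists 1, 1. split; [lra|]. split; [lra|].
  intros u _. rewrite Cmod_pow. lra.
Qed.

Lemma big_O_zero (n : nat) : big_O n (fun _ => 0).
Proof.
  exists 0, 1. split; [lra|]. split; [lra|].
  intros u _. rewrite Cmod_0. lra.
Qed.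

Lemma big_O_scal (n : nat) (a : C) (h : C -> C) :
  big_O n h -> big_O n (fun u => a * h u)%C.
Proof. intros H. apply (big_O_mult 0 n _ _ (big_O_const a) H). Qed.

Lemma big_O_minus (n : nat) (h1 h2 : C -> C) :
  big_O n h1 -> big_O n h2 -> big_O n (fun u => h1 u - h2 u)%C.
Proof.
  intros H1 H2. apply big_O_ext with (fun u => h1 u + (-(1)) * h2 u)%C.
  - intros u. ring.
  - apply big_O_plus; auto. apply big_O_scal; auto.
Qed.

Lemma big_O_comp (m n : nat) (h w : C -> C) :
  big_O n h -> big_O (S m) w -> big_O (S m * n) (fun u => h (w u)).
Proof.
  intros [K1 [d1 [HK1 [Hd1 H1]]]] [K2 [d2 [HK2 [Hd2 H2]]]].
  exists (K1 * K2 ^ n), (Rmin (Rmin d2 1) (d1 / (K2 + 1))).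
  assert (Hq : 0 < d1 / (K2 + 1)) by (apply Rdiv_lt_0_compat; lra).
  split; [apply Rmult_le_pos; auto; apply pow_le; auto|].
  split; [repeat apply Rmin_pos; lra|].
  intros u Hu.
  assert (Hu2 : Cmod u < d2).
  { apply Rlt_le_trans with (1 := Hu). eapply Rle_trans; [apply Rmin_l|apply Rmin_l]. }
  assert (Hu1 : Cmod u < 1).
  { apply Rlt_le_trans with (1 := Hu). eapply Rle_trans; [apply Rmin_l|apply Rmin_r]. }
  assert (Hu3 : Cmod u < d1 / (K2 + 1)).
  { apply Rlt_le_trans with (1 := Hu). apply Rmin_r. }
  assert (Hw := H2 u Hu2). pose proof (Cmod_ge_0 u) as Hu0.
  assert (Hw1 : K2 * Cmod u ^ S m <= K2 * Cmod u).
  { apply Rmult_le_compat_l; auto. rewrite <- (pow_1 (Cmod u)) at 2.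
    apply pow_le_pow_le1; [lra|lia]. }
  assert (Hw2 : Cmod (w u) < d1).
  { apply Rle_lt_trans with (K2 * Cmod u); [lra|].
    apply Rlt_le_trans with ((K2 + 1) * (d1 / (K2 + 1))).
    - nra.
    - right. field. lra. }
  apply Rle_trans with (1 := H1 _ Hw2).
  rewrite pow_mult, Rmult_assoc. apply Rmult_le_compat_l; auto.
  rewrite <- Rpow_mult_distr. apply pow_incr. split; [apply Cmod_ge_0|auto].
Qed.

Lemma taylor_ext (c d : nat -> C) (n : nat) (u : C) :
  (forall k, (k <= n)%nat -> c k = d k) -> taylor c n u = taylor d n u.
Proof.
  induction n as [|n IH]; simpl; intros H.
  - apply H. lia.
  - rewrite IH, (H (S n)); auto.
Qed.

Lemma taylor_S (c : nat -> C) (n : nat) (u : C) :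
  taylor c (S n) u = (c O + u * taylor (fun i => c (S i)) n u)%C.
Proof.
  induction n as [|n IH].
  - simpl. ring.
  - change (taylor c (S (S n)) u) with (taylor c (S n) u + c (S (S n)) * u ^ (S (S n)))%C.
    rewrite IH. cbn [taylor]. rewrite (Cpow_S u (S n)). ring.
Qed.

Lemma taylor_plus (c d : nat -> C) (n : nat) (u : C) :
  taylor (fun k => c k + d k)%C n u = (taylor c n u + taylor d n u)%C.
Proof. induction n as [|n IH]; simpl; [auto|]. rewrite IH. ring. Qed.

Lemma taylor_scal (a : C) (c : nat -> C) (n : nat) (u : C) :
  taylor (fun k => a * c k)%C n u = (a * taylor c n u)%C.
Proof. induction n as [|n IH]; simpl; [auto|]. rewrite IH. ring. Qed.

Lemma taylor_at_0 (c : nat -> C) (n : nat) : taylor c n 0 = c O.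
Proof.
  destruct n; [reflexivity|]. rewrite taylor_S. ring.
Qed.

Lemma taylor_bounded (c : nat -> C) (n : nat) : big_O 0 (taylor c n).
Proof.
  induction n as [|n IH]; [apply big_O_const|].
  change (big_O 0 (fun u => taylor c n u + c (S n) * u ^ S n)%C).
  apply big_O_plus; [exact IH|]. apply big_O_scal.
  apply big_O_le with (S n); [lia|]. apply big_O_pow.
Qed.

Lemma taylor_conv (n : nat) : forall c d : nat -> C,
  big_O (S n) (fun u => taylor c n u * taylor d n u - taylor (conv c d) n u)%C.
Proof.
  induction n as [|n IH]; intros c d.
  - apply big_O_ext with (fun _ : C => RtoC 0); [|apply big_O_zero].
    intros u. simpl. ring.
  - set (c' := fun i => c (S i)).
    apply big_O_ext with
      (fun u => u ^ 1 * (taylor c' n u * taylor d n u - taylor (conv c' d) n u)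
         + u ^ 1 * taylor c' n u * (d (S n) * u ^ S n))%C.
    + intros u.
      rewrite (taylor_S c n u), (taylor_S (conv c d) n u). fold c'.
      replace (taylor (fun i => conv c d (S i)) n u)
        with (c O * taylor (fun i => d (S i)) n u + taylor (conv c' d) n u)%C.
      * rewrite (taylor_S d n u). cbn [conv].
        replace (taylor d n u) with (taylor d (S n) u - d (S n) * u ^ S n)%C
          by (cbn [taylor]; ring).
        rewrite (taylor_S d n u). ring.
      * rewrite <- taylor_scal, <- taylor_plus. apply taylor_ext. intros k _. reflexivity.
    + apply big_O_plus.
      * apply (big_O_mult 1 (S n)); [apply big_O_pow|apply IH].
      * apply (big_O_mult 1 (S n)).
        -- apply (big_O_mult 1 0); [apply big_O_pow|apply taylor_bounded].
        -- apply big_O_scal, big_O_pow.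
Qed.

Lemma jet_ext (n : nat) (h : C -> C) (c d : nat -> C) :
  (forall k, (k <= n)%nat -> c k = d k) -> jet n h c -> jet n h d.
Proof.
  intros H. apply big_O_ext. intros u. now rewrite (taylor_ext c d).
Qed.

Lemma jet_near (n : nat) (h1 h2 : C -> C) (c : nat -> C) (r : R) :
  0 < r -> (forall u, Cmod u < r -> h1 u = h2 u) -> jet n h1 c -> jet n h2 c.
Proof.
  intros Hr H. apply big_O_near with (1 := Hr). intros u Hu. now rewrite H.
Qed.

Lemma jet_fun_ext (n : nat) (h1 h2 : C -> C) (c : nat -> C) :
  (forall u, h1 u = h2 u) -> jet n h1 c -> jet n h2 c.
Proof. intros H. apply jet_near with 1; [lra|auto]. Qed.

Lemma jet_of_big_O (n : nat) (h1 h2 : C -> C) (c : nat -> C) :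
  big_O (S n) (fun u => h1 u - h2 u)%C -> jet n h2 c -> jet n h1 c.
Proof.
  intros H1 H2. apply big_O_ext with (2 := big_O_plus _ _ _ H1 H2).
  intros u. ring.
Qed.

Lemma jet_bounded (n : nat) (h : C -> C) (c : nat -> C) :
  jet n h c -> big_O 0 h.
Proof.
  intros H. apply big_O_ext with (fun u => (h u - taylor c n u) + taylor c n u)%C.
  - intros u. ring.
  - apply big_O_plus; [|apply taylor_bounded]. apply big_O_le with (2 := H). lia.
Qed.

Lemma jet_value (n : nat) (h : C -> C) (c : nat -> C) :
  jet n h c -> h 0 = c O.
Proof.
  intros [K [d [_ [Hd H]]]].
  assert (H' : Cmod (h 0 - taylor c n 0) <= K * Cmod 0 ^ S n).
  { apply H. rewrite Cmod_0. exact Hd. }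
  rewrite Cmod_0, taylor_at_0, pow_ne_zero, Rmult_0_r in H' by lia.
  assert (E : Cmod (h 0 - c O) = 0) by (apply Rle_antisym; [auto|apply Cmod_ge_0]).
  apply Cmod_eq_0 in E. replace (h 0) with ((h 0 - c O) + c O)%C by ring.
  rewrite E. ring.
Qed.

Lemma jet_const (n : nat) (a : C) :
  jet n (fun _ => a) (fun k => match k with O => a | _ => 0 end).
Proof.
  apply big_O_ext with (fun _ : C => RtoC 0); [|apply big_O_zero].
  intros u. destruct n; [simpl; ring|]. rewrite taylor_S.
  rewrite (taylor_ext _ (fun _ => 0 * 0)%C) by (intros; ring).
  rewrite (taylor_scal 0). ring.
Qed.

Lemma jet_plus (n : nat) (h1 h2 : C -> C) (c d : nat -> C) :
  jet n h1 c -> jet n h2 d ->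
  jet n (fun u => h1 u + h2 u)%C (fun k => c k + d k)%C.
Proof.
  intros H1 H2. apply big_O_ext with (2 := big_O_plus _ _ _ H1 H2).
  intros u. rewrite taylor_plus. ring.
Qed.

Lemma jet_scal (n : nat) (a : C) (h : C -> C) (c : nat -> C) :
  jet n h c -> jet n (fun u => a * h u)%C (fun k => a * c k)%C.
Proof.
  intros H. apply big_O_ext with (2 := big_O_scal _ a _ H).
  intros u. rewrite taylor_scal. ring.
Qed.

Lemma jet_minus (n : nat) (h1 h2 : C -> C) (c d : nat -> C) :
  jet n h1 c -> jet n h2 d ->
  jet n (fun u => h1 u - h2 u)%C (fun k => c k - d k)%C.
Proof.
  intros H1 H2.
  apply jet_fun_ext with (fun u => h1 u + (-(1)) * h2 u)%C; [intros; ring|].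
  apply jet_ext with (fun k => c k + (-(1)) * d k)%C; [intros; ring|].
  apply jet_plus; auto. apply jet_scal; auto.
Qed.

Lemma jet_mult (n : nat) (h1 h2 : C -> C) (c d : nat -> C) :
  jet n h1 c -> jet n h2 d -> jet n (fun u => h1 u * h2 u)%C (conv c d).
Proof.
  intros H1 H2.
  apply big_O_ext with (fun u => (h1 u - taylor c n u) * h2 u
     + taylor c n u * (h2 u - taylor d n u)
     + (taylor c n u * taylor d n u - taylor (conv c d) n u))%C.
  - intros u. ring.
  - apply big_O_plus; [apply big_O_plus|apply taylor_conv].
    + replace (S n) with (S n + 0)%nat by lia.
      apply big_O_mult; auto. apply (jet_bounded _ _ _ H2).
    + apply (big_O_mult 0 (S n)); auto. apply taylor_bounded.
Qed.

Lemma jet_le (m n : nat) (h : C -> C) (c : nat -> C) :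
  (m <= n)%nat -> jet n h c -> jet m h c.
Proof.
  intros Hmn. induction Hmn as [|n Hmn IH]; auto.
  intros H. apply IH.
  apply big_O_ext with (fun u => (h u - taylor c (S n) u) + c (S n) * u ^ S n)%C.
  - intros u. simpl. ring.
  - apply big_O_plus; [apply big_O_le with (2 := H); lia|].
    apply big_O_scal, big_O_pow.
Qed.

Lemma jet_id (n : nat) :
  jet n (fun u => u) (fun k => match k with 1%nat => 1 | _ => 0 end).
Proof.
  destruct n.
  - apply big_O_ext with (fun u => u ^ 1)%C; [intros; simpl; ring|].
    apply big_O_pow.
  - apply big_O_ext with (fun _ : C => RtoC 0); [|apply big_O_zero].
    intros u. rewrite taylor_S.
    destruct n; [simpl; ring|]. rewrite taylor_S.
    rewrite (taylor_ext _ (fun _ => 0 * 0)%C) by (intros; ring).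
    rewrite (taylor_scal 0). ring.
Qed.

Lemma eq_0_of_le_Cmod (e : C) (K d : R) :
  0 < d -> (forall u : C, 0 < Cmod u < d -> Cmod e <= K * Cmod u) -> e = 0.
Proof.
  intros Hd H. apply Cmod_eq_0. apply Rle_antisym; [|apply Cmod_ge_0].
  apply le_epsilon. intros eps Heps. rewrite Rplus_0_l.
  set (t := Rmin (d / 2) (eps / (Rabs K + 1))).
  pose proof (Rabs_pos K) as HK. pose proof (Rle_abs K) as HK1.
  assert (Ht : 0 < t) by (apply Rmin_pos; [lra|apply Rdiv_lt_0_compat; lra]).
  assert (Ht2 : t <= d / 2) by apply Rmin_l.
  assert (Ht3 : t <= eps / (Rabs K + 1)) by apply Rmin_r.
  specialize (H (RtoC t)). rewrite Cmod_R, Rabs_pos_eq in H by lra.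
  apply Rle_trans with (1 := H ltac:(lra)).
  apply Rle_trans with ((Rabs K + 1) * (eps / (Rabs K + 1))).
  - nra.
  - right. field. lra.
Qed.

Lemma taylor_big_O_zero (n : nat) : forall e : nat -> C,
  (exists K d : R, 0 < d /\ forall u : C, 0 < Cmod u < d ->
     Cmod (taylor e n u) <= K * Cmod u ^ S n) ->
  forall k, (k <= n)%nat -> e k = 0.
Proof.
  induction n as [|n IH]; intros e [K [d [Hd H]]].
  - intros k Hk. replace k with O by lia.
    apply eq_0_of_le_Cmod with K d; auto. intros u Hu.
    rewrite <- (pow_1 (Cmod u)). apply (H u Hu).
  - destruct (taylor_bounded (fun i => e (S i)) n) as [M [d' [HM [Hd' HB]]]].
    assert (E0 : e O = 0).
    { apply eq_0_of_le_Cmod with (Rabs K + M) (Rmin (Rmin d d') 1);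
        [repeat apply Rmin_pos; lra|].
      intros u [Hu0 Hu].
      assert (Hu1 : Cmod u < d).
      { apply Rlt_le_trans with (1 := Hu). eapply Rle_trans; [apply Rmin_l|apply Rmin_l]. }
      assert (Hu2 : Cmod u < d').
      { apply Rlt_le_trans with (1 := Hu). eapply Rle_trans; [apply Rmin_l|apply Rmin_r]. }
      assert (Hu3 : Cmod u < 1).
      { apply Rlt_le_trans with (1 := Hu). apply Rmin_r. }
      specialize (H u (conj Hu0 Hu1)). specialize (HB u Hu2). simpl (_ ^ 0) in HB.
      rewrite taylor_S in H.
      replace (e O) with ((e O + u * taylor (fun i => e (S i)) n u)
          - u * taylor (fun i => e (S i)) n u)%C by ring.
      apply Rle_trans with (1 := Cmod_minus_le _ _). rewrite Cmod_mult.
      assert (Hp : Cmod u ^ S (S n) <= Cmod u).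
      { rewrite <- (pow_1 (Cmod u)) at 2. apply pow_le_pow_le1; [lra|lia]. }
      assert (Hp0 : 0 <= Cmod u ^ S (S n)) by (apply pow_le; lra).
      pose proof (Rle_abs K). pose proof (Rabs_pos K).
      assert (K * Cmod u ^ S (S n) <= Rabs K * Cmod u) by nra.
      nra. }
    intros [|k] Hk; [exact E0|].
    apply (IH (fun i => e (S i))); [|lia].
    exists K, d. split; [auto|]. intros u Hu.
    specialize (H u Hu). rewrite taylor_S, E0, Cplus_0_l, Cmod_mult in H.
    apply Rmult_le_reg_l with (Cmod u); [lra|].
    apply Rle_trans with (1 := H). right. simpl. ring.
Qed.

Lemma jet_unique (n : nat) (h : C -> C) (c d : nat -> C) :
  jet n h c -> jet n h d -> forall k, (k <= n)%nat -> c k = d k.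
Proof.
  intros H1 H2 k Hk.
  assert (E : (c k - d k = 0)%C).
  2:{ replace (c k) with ((c k - d k) + d k)%C by ring. rewrite E. ring. }
  apply (taylor_big_O_zero n (fun k => c k - d k)%C); auto.
  destruct (big_O_minus _ _ _ H2 H1) as [K [r [_ [Hr H]]]].
  exists K, r. split; auto. intros u Hu.
  replace (taylor (fun k0 => c k0 - d k0)%C n u)
    with ((h u - taylor d n u) - (h u - taylor c n u))%C; [apply H; lra|].
  rewrite (taylor_ext (fun k0 => c k0 - d k0)%C (fun k0 => c k0 + (-(1)) * d k0)%C)
    by (intros; ring).
  rewrite taylor_plus, taylor_scal. ring.
Qed.

Lemma taylor_shift (n m : nat) : forall (c : nat -> C) (u : C),
  (forall k, (k < n)%nat -> c k = 0) ->
  taylor c (n + m) u = (u ^ n * taylor (fun k => c (n + k)%nat) m u)%C.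
Proof.
  induction n as [|n IH]; intros c u H.
  - simpl. rewrite Cmult_1_l. reflexivity.
  - change (S n + m)%nat with (S (n + m)). rewrite taylor_S, H by lia.
    rewrite (IH (fun i => c (S i))) by (intros; apply H; lia).
    rewrite Cpow_S. change (fun k => c (S (n + k))) with (fun k => c (S n + k)%nat). ring.
Qed.

(** Dividing out a zero of order [n] lowers the order of the jet; the value at the
    origin has to be supplied because division by [0] carries no information. *)
Lemma jet_div_pow (n m : nat) (h q : C -> C) (c : nat -> C) :
  jet (n + m) h c -> (forall k, (k < n)%nat -> c k = 0) -> q 0 = c n ->
  (forall u : C, u <> 0 -> h u = u ^ n * q u)%C ->
  jet m q (fun k => c (n + k)%nat).
Proof.
  intros [K [d [HK [Hd H]]]] H0 Hq Hu. exists K, d. repeat split; auto.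
  intros u Hud. destruct (Ceq_dec u 0) as [->|Hn].
  - rewrite taylor_at_0, Hq, Nat.add_0_r. rewrite Cmod_0.
    replace (c n - c n)%C with (RtoC 0) by ring. rewrite Cmod_0.
    rewrite pow_ne_zero by lia. lra.
  - specialize (H u Hud). rewrite (Hu u Hn), taylor_shift in H by auto.
    replace (u ^ n * q u - u ^ n * taylor (fun k => c (n + k)%nat) m u)%C
      with (u ^ n * (q u - taylor (fun k => c (n + k)%nat) m u))%C in H by ring.
    rewrite Cmod_mult, Cmod_pow in H. apply Cmod_gt_0 in Hn.
    apply Rmult_le_reg_l with (Cmod u ^ n); [apply pow_lt; auto|].
    apply Rle_trans with (1 := H). right.
    replace (S (n + m)) with (n + S m)%nat by lia. rewrite pow_add. ring.
Qed.

Lemma jet_dilate (n : nat) (a : C) (h : C -> C) (c : nat -> C) :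
  jet n h c -> jet n (fun u => h (a * u)%C) (fun k => a ^ k * c k)%C.
Proof.
  intros H.
  assert (Ha : big_O 1 (fun u => a * u)%C).
  { apply big_O_scal. apply big_O_ext with (2 := big_O_pow 1). intros u. simpl. ring. }
  assert (H' := big_O_comp 0 (S n) _ _ H Ha). rewrite Nat.mul_1_l in H'.
  apply big_O_ext with (2 := H'). intros u. cbv beta. f_equal.
  clear. induction n as [|n IH]; cbn [taylor].
  - simpl. ring.
  - rewrite IH, Cpow_mult_l. ring.
Qed.

(** * A maximum principle *)

Definition usc_at (V : C -> R) (z0 : C) : Prop :=
  forall eps : R, 0 < eps -> exists d : R, 0 < d /\
    forall z : C, Cmod (z - z0) < d -> V z < V z0 + eps.

(** The mean over a circle is replaced by the mean over the vertices of a square. The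
    allowed error [s ^ 3] is negligible against the [s ^ 2] that a multiple of
    [|z|^2] contributes to such a mean. *)
Definition submean_at (V : C -> R) (z0 : C) : Prop :=
  exists K d : R, 0 < d /\ forall s : R, 0 < s < d ->
    V z0 - K * s ^ 3 <=
      (V (z0 + s)%C + V (z0 + Ci * s)%C + V (z0 - s)%C + V (z0 - Ci * s)%C) / 4.

Lemma Cmod_sqr_sub (a b : C) :
  Cmod (a - b) ^ 2 = Cmod a ^ 2 - 2 * Re (a * Cconj b) + Cmod b ^ 2.
Proof.
  rewrite !Cmod2_alt. destruct a as [a1 a2], b as [b1 b2].
  unfold Re, Im, Cconj, Cminus, Cplus, Copp, Cmult. simpl. ring.
Qed.

(** Attainment of maxima on the closed disc, in the form used below. If every point could
    be improved, a point [z'] improving on [z] would do so on a neighbourhood of [z];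
    the best of the finitely many [z'] of a finite subcover could not be improved. *)
Lemma no_improvement_on_disc (u : C -> R) (r : R) :
  0 <= r -> (forall z, Cmod z <= r -> usc_at u z) ->
  ~ (forall z, Cmod z <= r -> exists z', Cmod z' <= r /\ u z < u z').
Proof.
  intros Hr Husc Himp.
  set (near := fun (t : R * (R * unit)) (d : R) (w : C) =>
    Rabs (fst w - fst t) < d /\ Rabs (snd w - fst (snd t)) < d).
  set (pt := fun t : R * (R * unit) => ((fst t, fst (snd t)) : C)).
  assert (Hd : forall t : R * (R * unit), exists d : posreal,
     (Cmod (pt t) <= r -> exists z', Cmod z' <= r /\ forall w, near t d w -> u w < u z')
     /\ (r < Cmod (pt t) -> forall w, near t d w -> r < Cmod w)).
  { intros t.
    assert (Hn : forall (d : R) w, near t (d / 2) w -> Cmod (w - pt t) < d).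
    { intros d w [H1 H2].
      apply Rle_lt_trans with (1 := Cmod_2Rmax _).
      assert (Hs : sqrt 2 < 2).
      { apply Rsqr_incrst_0; [|apply sqrt_pos|lra]. unfold Rsqr.
        rewrite sqrt_sqrt; lra. }
      pose proof (sqrt_pos 2).
      assert (Hm : Rmax (Rabs (fst (w - pt t)%C)) (Rabs (snd (w - pt t)%C)) < d / 2).
      { apply Rmax_lub_lt; [exact H1|exact H2]. }
      pose proof (Rmax_l (Rabs (fst (w - pt t)%C)) (Rabs (snd (w - pt t)%C))).
      pose proof (Rabs_pos (fst (w - pt t)%C)). nra. }
    destruct (Rle_lt_dec (Cmod (pt t)) r) as [Ht|Ht].
    - destruct (Himp _ Ht) as [z' [Hz' Hlt]].
      destruct (Husc _ Ht (u z' - u (pt t)) ltac:(lra)) as [d [Hdp Hd]].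
      exists (mkposreal (d / 2) ltac:(lra)). split; [|intros; lra].
      intros _. exists z'. split; auto. intros w Hw.
      specialize (Hd w (Hn _ _ Hw)). lra.
    - set (d := Cmod (pt t) - r).
      exists (mkposreal (d / 2) ltac:(unfold d; lra)). split; [intros; lra|].
      intros _ w Hw. specialize (Hn _ _ Hw).
      pose proof (Cmod_minus_le w (w - pt t)) as Htri.
      replace (w - (w - pt t))%C with (pt t) in Htri by ring. unfold d in Hn. lra. }
  set (delta := fun t => proj1_sig (constructive_indefinite_description _ (Hd t))).
  assert (Hdelta := fun t => proj2_sig (constructive_indefinite_description _ (Hd t))).
  fold delta in Hdelta.
  apply (compactness_list 2 (-r, (-r, tt)) (r, (r, tt)) delta).
  intros [l Hl].
  assert (Hz : exists z', Cmod z' <= r /\ forall t, In t l -> Cmod (pt t) <= r ->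
     forall w, near t (delta t) w -> u w < u z').
  { clear Hl. induction l as [|t l [z' [Hz' IH]]].
    - exists 0. rewrite Cmod_0. split; [auto|]. intros t [].
    - destruct (Rle_lt_dec (Cmod (pt t)) r) as [Ht|Ht].
      + destruct (proj1 (Hdelta t) Ht) as [z2 [Hz2 H2]].
        destruct (Rle_lt_dec (u z') (u z2)) as [Hu|Hu].
        * exists z2. split; auto. intros t' [<-|Ht'] Hr' w Hw; auto.
          specialize (IH t' Ht' Hr' w Hw). lra.
        * exists z'. split; auto. intros t' [<-|Ht'] Hr' w Hw.
          -- specialize (H2 w Hw). lra.
          -- apply (IH t' Ht' Hr' w Hw).
      + exists z'. split; auto. intros t' [<-|Ht'] Hr' w Hw; [lra|].
        apply (IH t' Ht' Hr' w Hw). }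
  destruct Hz as [z' [Hz' Hall]].
  destruct (Hl (fst z', (snd z', tt))) as [t [Hin [_ Hclose]]].
  { pose proof (Rmax_Cmod z') as Hm.
    pose proof (Rmax_l (Rabs (fst z')) (Rabs (snd z'))) as H1.
    pose proof (Rmax_r (Rabs (fst z')) (Rabs (snd z'))) as H2.
    assert (H3 : - r <= fst z' <= r) by (apply Rabs_le_between; lra).
    assert (H4 : - r <= snd z' <= r) by (apply Rabs_le_between; lra).
    simpl. repeat split; lra. }
  assert (Hnear : near t (delta t) z').
  { destruct t as [t1 [t2 []]]. destruct Hclose as [H1 [H2 _]]. split; auto. }
  destruct (Rle_lt_dec (Cmod (pt t)) r) as [Ht|Ht].
  - specialize (Hall t Hin Ht z' Hnear). lra.
  - specialize (proj2 (Hdelta t) Ht z' Hnear). lra.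
Qed.

Lemma usc_at_plus (V W : C -> R) (z0 : C) :
  usc_at V z0 -> usc_at W z0 -> usc_at (fun z => V z + W z) z0.
Proof.
  intros HV HW eps Heps.
  destruct (HV (eps / 2) ltac:(lra)) as [d1 [Hd1 H1]].
  destruct (HW (eps / 2) ltac:(lra)) as [d2 [Hd2 H2]].
  exists (Rmin d1 d2). split; [apply Rmin_pos; auto|]. intros z Hz.
  specialize (H1 z (Rlt_le_trans _ _ _ Hz (Rmin_l _ _))).
  specialize (H2 z (Rlt_le_trans _ _ _ Hz (Rmin_r _ _))). lra.
Qed.

Lemma submean_at_plus (V W : C -> R) (z0 : C) :
  submean_at V z0 -> submean_at W z0 -> submean_at (fun z => V z + W z) z0.
Proof.
  intros [K1 [d1 [Hd1 H1]]] [K2 [d2 [Hd2 H2]]].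
  exists (K1 + K2), (Rmin d1 d2). split; [apply Rmin_pos; auto|].
  intros s [Hs0 Hs].
  specialize (H1 s (conj Hs0 (Rlt_le_trans _ _ _ Hs (Rmin_l _ _)))).
  specialize (H2 s (conj Hs0 (Rlt_le_trans _ _ _ Hs (Rmin_r _ _)))). lra.
Qed.

Lemma usc_at_Cmod_sqr (F : C -> C) (z0 : C) (c : nat -> C) :
  jet 2 (fun u => F (z0 + u)%C) c -> usc_at (fun z => Cmod (F z) ^ 2) z0.
Proof.
  intros HJ eps Heps.
  assert (Hc := jet_value _ _ _ HJ). simpl in Hc. rewrite Cplus_0_r in Hc.
  assert (HJ0 := jet_le 0 2 _ _ ltac:(lia) HJ).
  destruct HJ0 as [K [d [HK [Hd H]]]]. simpl in H.
  set (m := Cmod (F z0)). assert (Hm : 0 <= m) by apply Cmod_ge_0.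
  set (e := Rmin 1 (eps / (2 * m + 2))).
  assert (He : 0 < e) by (apply Rmin_pos; [lra|apply Rdiv_lt_0_compat; lra]).
  assert (He1 : e <= 1) by apply Rmin_l.
  assert (He2 : e * (2 * m + 2) <= eps).
  { apply Rle_trans with (eps / (2 * m + 2) * (2 * m + 2)).
    - apply Rmult_le_compat_r; [lra|]. apply Rmin_r.
    - right. field. lra. }
  exists (Rmin d (e / (K + 1))).
  split; [apply Rmin_pos; auto; apply Rdiv_lt_0_compat; lra|].
  intros z Hz.
  assert (Hz1 := Rlt_le_trans _ _ _ Hz (Rmin_l _ _)).
  assert (Hz2 := Rlt_le_trans _ _ _ Hz (Rmin_r _ _)).
  specialize (H (z - z0)%C Hz1). replace (z0 + (z - z0))%C with z in H by ring.
  rewrite <- Hc, Rmult_1_r in H.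
  assert (Hdz : Cmod (F z) < m + e).
  { replace (F z) with ((F z - F z0) + F z0)%C by ring.
    apply Rle_lt_trans with (1 := Cmod_triangle _ _). fold m.
    assert (K * Cmod (z - z0) < e); [|lra].
    pose proof (Cmod_ge_0 (z - z0)).
    apply Rle_lt_trans with ((K + 1) * Cmod (z - z0)); [nra|].
    apply Rlt_le_trans with ((K + 1) * (e / (K + 1))).
    - apply Rmult_lt_compat_l; lra.
    - right. field. lra. }
  fold m. pose proof (Cmod_ge_0 (F z)). nra.
Qed.

(** Averaging over the four points [z0 + s], [z0 + i s], [z0 - s], [z0 - i s]
    kills the linear and the quadratic Taylor terms of [F], so the mean of [F] is
    [F z0] up to [O(s ^ 3)]; convexity of the squared modulus does the rest. *)
Lemma submean_at_Cmod_sqr (F : C -> C) (z0 : C) (c : nat -> C) :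
  jet 2 (fun u => F (z0 + u)%C) c -> submean_at (fun z => Cmod (F z) ^ 2) z0.
Proof.
  intros HJ.
  assert (Hc := jet_value _ _ _ HJ). simpl in Hc. rewrite Cplus_0_r in Hc.
  destruct HJ as [K [d [HK [Hd H]]]].
  exists (2 * Cmod (F z0) * K), d. split; auto. intros s Hs.
  set (e := fun u => (F (z0 + u) - taylor c 2 u)%C).
  change (forall u, Cmod u < d -> Cmod (e u) <= K * Cmod u ^ 3) in H.
  assert (Hms : Cmod s = s) by (rewrite Cmod_R, Rabs_pos_eq; lra).
  assert (Hmi : Cmod (Ci * s) = s) by (rewrite Cmod_mult, Cmod_Ci, Hms; ring).
  assert (H1 := H s ltac:(rewrite Hms; lra)).
  assert (H2 := H (Ci * s)%C ltac:(rewrite Hmi; lra)).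
  assert (H3 := H (- s)%C ltac:(rewrite Cmod_opp, Hms; lra)).
  assert (H4 := H (- (Ci * s))%C ltac:(rewrite Cmod_opp, Hmi; lra)).
  rewrite ?Cmod_opp, ?Hms, ?Hmi in *.
  change (z0 - s)%C with (z0 + - s)%C. change (z0 - Ci * s)%C with (z0 + - (Ci * s))%C.
  assert (Hi2 : (Ci * Ci = -(1))%C).
  { unfold Ci, Cmult, Copp, RtoC. simpl. f_equal; ring. }
  assert (Hsum : (F (z0 + s) + F (z0 + Ci * s) + F (z0 + - s) + F (z0 + - (Ci * s))
     = 4 * F z0 + (e s + e (Ci * s) + e (- s) + e (- (Ci * s))))%C).
  { unfold e. simpl taylor. rewrite Hc.
    transitivity (F (z0 + s) + F (z0 + Ci * s) + F (z0 + - s) + F (z0 + - (Ci * s))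
       - (2 * c 2%nat * s * s * (Ci * Ci + 1)))%C; [rewrite Hi2; ring|ring]. }
  set (E := (e s + e (Ci * s) + e (- s) + e (- (Ci * s)))%C) in Hsum.
  assert (HE : Cmod E <= 4 * (K * s ^ 3)).
  { unfold E. pose proof (Cmod_triangle (e s + e (Ci * s) + e (- s))%C (e (- (Ci * s)))%C).
    pose proof (Cmod_triangle (e s + e (Ci * s))%C (e (- s)%C)).
    pose proof (Cmod_triangle (e s) (e (Ci * s)%C)). lra. }
  assert (Hsq : forall a, 2 * Re (a * Cconj (F z0)) - Cmod (F z0) ^ 2 <= Cmod a ^ 2).
  { intros a. pose proof (Cmod_sqr_sub a (F z0)). pose proof (pow2_ge_0 (Cmod (a - F z0))).
    lra. }
  pose proof (Hsq (F (z0 + s))%C) as Q1. pose proof (Hsq (F (z0 + Ci * s))%C) as Q2.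
  pose proof (Hsq (F (z0 + - s))%C) as Q3.
  pose proof (Hsq (F (z0 + - (Ci * s)))%C) as Q4.
  assert (HRe : Re (F (z0 + s) * Cconj (F z0))%C + Re (F (z0 + Ci * s) * Cconj (F z0))%C
     + Re (F (z0 + - s) * Cconj (F z0))%C + Re (F (z0 + - (Ci * s)) * Cconj (F z0))%C
     = 4 * Cmod (F z0) ^ 2 + Re (E * Cconj (F z0))%C).
  { rewrite <- !re_plus, <- !Cmult_plus_distr_r, Hsum.
    rewrite Cmult_plus_distr_r, re_plus. f_equal.
    rewrite Cmod2_alt. destruct (F z0) as [x y].
    unfold Re, Im, Cconj, Cmult, RtoC. simpl. ring. }
  assert (HRb : - (4 * (K * s ^ 3) * Cmod (F z0)) <= Re (E * Cconj (F z0))%C).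
  { pose proof (re_le_Cmod (E * Cconj (F z0))) as Hr.
    rewrite Cmod_mult, Cmod_conj in Hr.
    apply Rabs_le_between in Hr. pose proof (Cmod_ge_0 (F z0)). nra. }
  nra.
Qed.

Lemma maximum_principle (V : C -> R) (r B : R) :
  0 < r ->
  (forall z, Cmod z <= r -> usc_at V z) ->
  (forall z, Cmod z < r -> submean_at V z) ->
  (forall z, Cmod z = r -> V z <= B) ->
  V 0 <= B.
Proof.
  intros Hr Husc Hsub HB. apply Rnot_lt_le. intros Hlt.
  (* a small multiple of |z|^2 makes the mean inequality strict *)
  set (eps := (V 0 - B) / (2 * r ^ 2)).
  assert (Hr2 : 0 < r ^ 2) by nra.
  assert (Heps : 0 < eps) by (apply Rdiv_lt_0_compat; lra).
  assert (Heps2 : eps * r ^ 2 = (V 0 - B) / 2) by (unfold eps; field; lra).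
  set (u := fun z => V z + eps * Cmod z ^ 2).
  apply (no_improvement_on_disc u r); [lra| |].
  - intros z Hz. apply usc_at_plus; [auto|].
    intros e He.
    destruct (usc_at_Cmod_sqr (fun z => z) z
      (fun k => match k with O => z | 1%nat => RtoC 1 | _ => RtoC 0 end)) with (e / eps)
      as [d [Hd H]].
    + apply big_O_ext with (fun _ => RtoC 0); [|apply big_O_zero].
      intros x. simpl. ring.
    + apply Rdiv_lt_0_compat; lra.
    + exists d. split; auto. intros w Hw. specialize (H w Hw).
      replace e with (eps * (e / eps)) by (field; lra). nra.
  - intros z Hz. destruct Hz as [Hz|Hz].
    + destruct (Hsub z Hz) as [K [d [Hd H]]].
      set (s := Rmin (Rmin (d / 2) ((r - Cmod z) / 2)) (eps / (2 * (Rabs K + 1)))).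
      pose proof (Rabs_pos K) as HK0. pose proof (Rle_abs K) as HK1.
      assert (Hq : 0 < eps / (2 * (Rabs K + 1))) by (apply Rdiv_lt_0_compat; lra).
      assert (Hs0 : 0 < s) by (repeat apply Rmin_pos; lra).
      assert (Hs1 : s <= d / 2) by (eapply Rle_trans; [apply Rmin_l|apply Rmin_l]).
      assert (Hs2 : s <= (r - Cmod z) / 2)
        by (eapply Rle_trans; [apply Rmin_l|apply Rmin_r]).
      assert (Hs3 : s * (2 * (Rabs K + 1)) <= eps).
      { apply Rle_trans with (eps / (2 * (Rabs K + 1)) * (2 * (Rabs K + 1))).
        - apply Rmult_le_compat_r; [lra|]. apply Rmin_r.
        - right. field. lra. }
      specialize (H s ltac:(lra)).
      assert (Hms : Cmod s = s) by (rewrite Cmod_R, Rabs_pos_eq; lra).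
      assert (Hmi : Cmod (Ci * s) = s) by (rewrite Cmod_mult, Cmod_Ci, Hms; ring).
      assert (Hav : Cmod (z + s) ^ 2 + Cmod (z + Ci * s) ^ 2 + Cmod (z - s) ^ 2
         + Cmod (z - Ci * s) ^ 2 = 4 * (Cmod z ^ 2 + s ^ 2)).
      { rewrite !Cmod2_alt. destruct z as [x y].
        unfold Re, Im, Ci, Cminus, Cplus, Copp, Cmult, RtoC. simpl. ring. }
      assert (Hin : forall w, Cmod w = s -> Cmod (z + w) <= r /\ Cmod (z - w) <= r).
      { intros w Hw. pose proof (Cmod_triangle z w). pose proof (Cmod_minus_le z w). lra. }
      assert (Hks : K * s ^ 3 < eps * s ^ 2).
      { assert (K * s <= Rabs K * s) by nra.
        assert (K * s < eps) by nra.
        replace (K * s ^ 3) with ((K * s) * s ^ 2) by ring.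
        apply Rmult_lt_compat_r; [apply pow_lt; auto|auto]. }
      destruct (Rlt_le_dec (u z) (u (z + s)%C)) as [G1|G1];
        [exists (z + s)%C; split; [apply Hin; auto|auto]|].
      destruct (Rlt_le_dec (u z) (u (z + Ci * s)%C)) as [G2|G2];
        [exists (z + Ci * s)%C; split; [apply Hin; auto|auto]|].
      destruct (Rlt_le_dec (u z) (u (z - s)%C)) as [G3|G3];
        [exists (z - s)%C; split; [apply Hin; auto|auto]|].
      destruct (Rlt_le_dec (u z) (u (z - Ci * s)%C)) as [G4|G4];
        [exists (z - Ci * s)%C; split; [apply Hin; auto|auto]|].
      exfalso. unfold u in G1, G2, G3, G4. nra.
    + exists 0. split; [rewrite Cmod_0; lra|].
      unfold u. rewrite Hz, Cmod_0. specialize (HB z Hz). nra.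
Qed.

(** * Coefficient inequalities for functions bounded on a circle *)

(** The maximum principle uses nothing beyond second-order expansions, and these, unlike
    local power series, pass to products and quotients at once. *)
Definition smooth_at (F : C -> C) (z0 : C) : Prop :=
  exists c : nat -> C, jet 2 (fun u => F (z0 + u)%C) c.

Lemma smooth_at_ext (F G : C -> C) (z0 : C) (r : R) :
  0 < r -> (forall z, Cmod (z - z0) < r -> F z = G z) ->
  smooth_at F z0 -> smooth_at G z0.
Proof.
  intros Hr H [c Hc]. exists c. apply jet_near with (1 := Hr) (3 := Hc).
  intros u Hu. apply H. replace (z0 + u - z0)%C with u by ring. auto.
Qed.

Lemma smooth_at_plus (F G : C -> C) (z0 : C) :
  smooth_at F z0 -> smooth_at G z0 -> smooth_at (fun z => F z + G z)%C z0.
Proof. intros [c Hc] [d Hd]. exists (fun k => c k + d k)%C. apply jet_plus; auto. Qed.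

Lemma smooth_at_mult (F G : C -> C) (z0 : C) :
  smooth_at F z0 -> smooth_at G z0 -> smooth_at (fun z => F z * G z)%C z0.
Proof. intros [c Hc] [d Hd]. exists (conv c d). apply jet_mult; auto. Qed.

Lemma smooth_at_const (a z0 : C) : smooth_at (fun _ => a) z0.
Proof. eexists. apply jet_const. Qed.

Lemma smooth_at_id (z0 : C) : smooth_at (fun z => z) z0.
Proof. eexists. apply jet_plus; [apply jet_const|apply jet_id]. Qed.

Lemma smooth_at_pow (F : C -> C) (z0 : C) (n : nat) :
  smooth_at F z0 -> smooth_at (fun z => F z ^ n)%C z0.
Proof.
  intros H. induction n as [|n IH].
  - apply (smooth_at_const 1).
  - apply (smooth_at_mult F _ z0 H IH).
Qed.

Lemma smooth_at_dilate (F : C -> C) (a z0 : C) :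
  smooth_at F (a * z0)%C -> smooth_at (fun z => F (a * z)%C) z0.
Proof.
  intros [c Hc]. eexists.
  apply jet_fun_ext with (2 := jet_dilate _ a _ _ Hc).
  intros u. cbv beta. f_equal. ring.
Qed.

Lemma smooth_at_inv (z0 : C) : z0 <> 0 -> smooth_at (fun z => / z)%C z0.
Proof.
  intros Hz. assert (Hm := proj1 (Cmod_gt_0 z0) Hz).
  exists (fun k => match k with
     | O => / z0 | 1%nat => - / z0 ^ 2 | _ => / z0 ^ 3 end)%C.
  exists (/ Cmod z0 ^ 3 * (2 / Cmod z0)), (Cmod z0 / 2).
  assert (H3 : 0 < / Cmod z0 ^ 3) by (apply Rinv_0_lt_compat, pow_lt; auto).
  assert (H4 : 0 < 2 / Cmod z0) by (apply Rdiv_lt_0_compat; lra).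
  split; [nra|]. split; [lra|].
  intros u Hu.
  assert (Hzu : Cmod z0 / 2 <= Cmod (z0 + u)).
  { pose proof (Cmod_minus_le (z0 + u)%C u) as Ht.
    replace (z0 + u - u)%C with z0 in Ht by ring. lra. }
  assert (Hn : (z0 + u)%C <> 0) by (apply Cmod_gt_0; lra).
  assert (E : (/ (z0 + u) - taylor (fun k => match k with
     | O => / z0 | 1%nat => - / z0 ^ 2 | _ => / z0 ^ 3 end) 2 u
     = - (u ^ 3 * (/ z0 ^ 3 * / (z0 + u))))%C).
  { simpl. field. auto. }
  rewrite E, Cmod_opp, !Cmod_mult, !Cmod_inv, !Cmod_pow by (auto; apply Cpow_nz; auto).
  rewrite (Rmult_comm _ (Cmod u ^ 3)).
  apply Rmult_le_compat_l; [apply pow_le, Cmod_ge_0|].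
  apply Rmult_le_compat_l; [lra|].
  replace (2 / Cmod z0) with (/ (Cmod z0 / 2)) by (field; lra).
  apply Rinv_le_contravar; lra.
Qed.

Lemma Ci_sqr : (Ci * Ci = -(1))%C.
Proof. unfold Ci, Cmult, Copp, RtoC. simpl. f_equal; ring. Qed.

(** For [e = Ci ^ (- n)] this is the part of [h] made of the powers [z ^ k] with
    [k = n] modulo [4]. *)
Definition rotation_mean (h : C -> C) (e z : C) : C :=
  ((h z + e * h (Ci * z) + e ^ 2 * h (- (1) * z) + e ^ 3 * h (- Ci * z)) / 4)%C.

Lemma Cmod_rotation_mean (h : C -> C) (z : C) :
  Cmod (rotation_mean h (- Ci) z) ^ 2 + Cmod (rotation_mean h (- (1)) z) ^ 2
  + Cmod (rotation_mean h Ci z) ^ 2 + Cmod (rotation_mean h 1 z) ^ 2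
  = (Cmod (h z) ^ 2 + Cmod (h (Ci * z)%C) ^ 2 + Cmod (h (- (1) * z)%C) ^ 2
     + Cmod (h (- Ci * z)%C) ^ 2) / 4.
Proof.
  rewrite !Cmod2_alt. unfold rotation_mean.
  destruct (h z) as [a1 a2], (h (Ci * z)%C) as [b1 b2],
    (h (- (1) * z)%C) as [c1 c2], (h (- Ci * z)%C) as [d1 d2].
  unfold Re, Im, Ci, Cdiv, Cinv, Cplus, Copp, Cmult, RtoC. simpl. field.
Qed.

Lemma smooth_at_rotation_mean (h : C -> C) (e z : C) :
  (forall w, Cmod w = Cmod z -> smooth_at h w) -> smooth_at (rotation_mean h e) z.
Proof.
  intros H. unfold rotation_mean, Cdiv.
  assert (Hd : forall a, Cmod a = 1 -> smooth_at (fun z => h (a * z)%C) z).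
  { intros a Ha. apply smooth_at_dilate, H. rewrite Cmod_mult, Ha. ring. }
  apply smooth_at_mult; [|apply smooth_at_const].
  repeat apply smooth_at_plus.
  - apply H; auto.
  - apply smooth_at_mult; [apply smooth_at_const|apply Hd, Cmod_Ci].
  - apply smooth_at_mult; [apply smooth_at_const|apply Hd, Cmod_m1].
  - apply smooth_at_mult; [apply smooth_at_const|apply Hd].
    rewrite Cmod_opp. apply Cmod_Ci.
Qed.

Lemma jet_rotation_mean (m : nat) (h : C -> C) (e : C) (b : nat -> C) :
  jet m h b ->
  jet m (rotation_mean h e)
    (fun k => (1 + e * Ci ^ k + e ^ 2 * (- (1)) ^ k + e ^ 3 * (- Ci) ^ k) / 4 * b k)%C.
Proof.
  intros H. unfold rotation_mean.
  assert (Hd : forall x a, jet m (fun u => x * h (a * u))%C (fun k => x * (a ^ k * b k))%C).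
  { intros x a. apply (jet_scal m x), jet_dilate, H. }
  apply (jet_fun_ext m (fun u => / 4 * (h u + e * h (Ci * u) + e ^ 2 * h (- (1) * u)
    + e ^ 3 * h (- Ci * u)))%C); [intros u; unfold Cdiv; ring|].
  apply (jet_ext m _ (fun k => / 4 * (b k + e * (Ci ^ k * b k)
    + e ^ 2 * ((- (1)) ^ k * b k) + e ^ 3 * ((- Ci) ^ k * b k)))%C).
  - intros k _. unfold Cdiv. ring.
  - apply (jet_scal m (/ 4)%C). repeat apply jet_plus; [exact H|apply Hd..].
Qed.

Lemma rotation_mean_quotient (h : C -> C) (b : nat -> C) (e : C) (n : nat) (s r : R) :
  (1 <= n <= 4)%nat ->
  (forall k, (k <= 6)%nat ->
     ((1 + e * Ci ^ k + e ^ 2 * (- (1)) ^ k + e ^ 3 * (- Ci) ^ k) / 4 * b k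
      = if Nat.eqb k n then b k else if Nat.eqb k (n + 4) then b k else 0)%C) ->
  (forall z, Cmod z <= r -> smooth_at h z) -> jet 6 h b ->
  exists G : C -> C, G 0 = (s * b n)%C /\
    (forall z, Cmod z <= r -> smooth_at G z) /\
    (forall z : C, z <> 0 -> G z = s * rotation_mean h e z / z ^ n)%C.
Proof.
  intros Hn Hk Hs HJ.
  set (q := fun z => if Ceq_dec z 0 then b n else (rotation_mean h e z / z ^ n)%C).
  exists (fun z => s * q z)%C.
  assert (Hq0 : q 0 = b n).
  { unfold q. destruct (Ceq_dec 0 0) as [_|N]; [reflexivity|now destruct N]. }
  assert (Hq : forall z : C, z <> 0 -> q z = (rotation_mean h e z / z ^ n)%C).
  { intros z Hz. unfold q. destruct (Ceq_dec z 0) as [E|_]; [now destruct Hz|reflexivity]. }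
  split; [now rewrite Hq0|]. split.
  - intros z Hz. apply smooth_at_mult; [apply smooth_at_const|].
    destruct (Ceq_dec z 0) as [->|Hz0].
    + eexists. apply jet_fun_ext with q; [intros u; now rewrite Cplus_0_l|].
      apply jet_div_pow with (n := n) (h := rotation_mean h e)
        (c := fun k => if Nat.eqb k n then b k else if Nat.eqb k (n + 4) then b k else 0).
      * apply jet_ext with (2 := jet_le (n + 2) 6 _ _ ltac:(lia)
           (jet_rotation_mean 6 h e b HJ)).
        intros k Hk'. apply Hk. lia.
      * intros k Hkn. rewrite (proj2 (Nat.eqb_neq k n)) by lia.
        now rewrite (proj2 (Nat.eqb_neq k (n + 4))) by lia.
      * now rewrite Nat.eqb_refl.
      * intros u Hu. rewrite Hq by auto. field. apply Cpow_nz; auto.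
    + apply smooth_at_ext with (fun z => rotation_mean h e z * (/ z) ^ n)%C (Cmod z).
      * apply Cmod_gt_0; auto.
      * intros w Hw. assert (Hw0 : w <> 0).
        { intros ->. replace (0 - z)%C with (- z)%C in Hw by ring.
          rewrite Cmod_opp in Hw. lra. }
        rewrite Hq by auto. unfold Cdiv. rewrite Cpow_inv; auto.
      * apply smooth_at_mult.
        -- apply smooth_at_rotation_mean. intros w Hw. apply Hs. lra.
        -- apply smooth_at_pow, smooth_at_inv; auto.
  - intros z Hz. rewrite Hq by auto. unfold Cdiv. ring.
Qed.

(** Parseval's inequality for the first four coefficients. The circle mean of
    [|h|^2] is replaced by the mean over the four rotations by powers of [Ci],
    which decouples the residue classes of exponents modulo [4]; each class, divided
    by its leading power, is again smooth, so the maximum principle carries the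
    bound from the circle to the origin. *)
Lemma coefficient_l2_bound (h : C -> C) (b : nat -> C) (r B : R) :
  0 < r -> (forall z, Cmod z <= r -> smooth_at h z) -> jet 6 h b -> b O = 0 ->
  (forall z, Cmod z = r ->
     Cmod (h z) ^ 2 + Cmod (h (Ci * z)%C) ^ 2 + Cmod (h (- (1) * z)%C) ^ 2
     + Cmod (h (- Ci * z)%C) ^ 2 <= 4 * B) ->
  Cmod (b 1%nat) ^ 2 * r ^ 2 + Cmod (b 2%nat) ^ 2 * r ^ 4
  + Cmod (b 3%nat) ^ 2 * r ^ 6 + Cmod (b 4%nat) ^ 2 * r ^ 8 <= B.
Proof.
  intros Hr Hs HJ Hb0 HB.
  assert (Hcoef : forall (e : C) (n : nat), (1 <= n <= 4)%nat ->
     (n = 1%nat /\ e = - Ci \/ n = 2%nat /\ e = - (1) \/ n = 3%nat /\ e = Ci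
      \/ n = 4%nat /\ e = 1)%C ->
     forall k, (k <= 6)%nat ->
     ((1 + e * Ci ^ k + e ^ 2 * (- (1)) ^ k + e ^ 3 * (- Ci) ^ k) / 4 * b k
      = if Nat.eqb k n then b k else if Nat.eqb k (n + 4) then b k else 0)%C).
  { intros e n _ Hen k Hk.
    assert (Hfin : forall x y : R, (x, y) = (RtoC 0) -> ((x,y) / 4 * b k = 0)%C).
    { intros x y ->. unfold Cdiv. ring. }
    assert (Hf4 : forall x y : R, (x, y) = (RtoC 4) -> ((x,y) / 4 * b k = b k)%C).
    { intros x y ->. field. }
    destruct Hen as [[-> ->]|[[-> ->]|[[-> ->]|[-> ->]]]];
      do 7 (destruct k as [|k]; [cbn [Nat.eqb Nat.add];
        try (apply Hfin; unfold Ci, Cmult, Copp, Cplus, RtoC; simpl; f_equal; ring);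
        try (apply Hf4; unfold Ci, Cmult, Copp, Cplus, RtoC; simpl; f_equal; ring);
        rewrite Hb0; ring|]); lia. }
  destruct (rotation_mean_quotient h b (- Ci)%C 1 r r ltac:(lia)
    (Hcoef (- Ci)%C 1%nat ltac:(lia) ltac:(tauto)) Hs HJ) as [G1 [G10 [G1s G1e]]].
  destruct (rotation_mean_quotient h b (- (1))%C 2 (r ^ 2) r ltac:(lia)
    (Hcoef (- (1))%C 2%nat ltac:(lia) ltac:(tauto)) Hs HJ) as [G2 [G20 [G2s G2e]]].
  destruct (rotation_mean_quotient h b Ci 3 (r ^ 3) r ltac:(lia)
    (Hcoef Ci 3%nat ltac:(lia) ltac:(tauto)) Hs HJ) as [G3 [G30 [G3s G3e]]].
  destruct (rotation_mean_quotient h b 1 4 (r ^ 4) r ltac:(lia)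
    (Hcoef 1 4%nat ltac:(lia) ltac:(tauto)) Hs HJ) as [G4 [G40 [G4s G4e]]].
  assert (Hmax := maximum_principle
    (fun z => Cmod (G1 z) ^ 2 + Cmod (G2 z) ^ 2 + Cmod (G3 z) ^ 2 + Cmod (G4 z) ^ 2) r B).
  cbv beta in Hmax.
  rewrite G10, G20, G30, G40, !Cmod_mult, !Cmod_R, !Rabs_pos_eq in Hmax
    by (try apply pow_le; lra).
  replace (Cmod (b 1%nat) ^ 2 * r ^ 2 + Cmod (b 2%nat) ^ 2 * r ^ 4
    + Cmod (b 3%nat) ^ 2 * r ^ 6 + Cmod (b 4%nat) ^ 2 * r ^ 8)
    with ((r * Cmod (b 1%nat)) ^ 2 + (r ^ 2 * Cmod (b 2%nat)) ^ 2
      + (r ^ 3 * Cmod (b 3%nat)) ^ 2 + (r ^ 4 * Cmod (b 4%nat)) ^ 2) by ring.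
  apply Hmax; [auto| | |].
  - intros z Hz. destruct (G1s z Hz) as [c1 H1], (G2s z Hz) as [c2 H2],
      (G3s z Hz) as [c3 H3], (G4s z Hz) as [c4 H4].
    repeat apply usc_at_plus; eapply usc_at_Cmod_sqr; eassumption.
  - intros z Hz. apply Rlt_le in Hz.
    destruct (G1s z Hz) as [c1 H1], (G2s z Hz) as [c2 H2],
      (G3s z Hz) as [c3 H3], (G4s z Hz) as [c4 H4].
    repeat apply submean_at_plus; eapply submean_at_Cmod_sqr; eassumption.
  - intros z Hz.
    assert (Hz0 : z <> 0) by (apply Cmod_gt_0; lra).
    assert (Hmod : forall (n : nat) (x : C),
       Cmod (RtoC (r ^ n) * x / z ^ n)%C = Cmod x).
    { intros n x. rewrite Cmod_div, Cmod_mult, Cmod_pow, Hz, Cmod_R by (apply Cpow_nz; auto).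
      rewrite Rabs_pos_eq by (apply pow_le; lra). field. apply pow_nonzero; lra. }
    rewrite G1e, G2e, G3e, G4e by auto.
    rewrite <- (pow_1 r) at 1. rewrite !Hmod, Cmod_rotation_mean.
    specialize (HB z Hz). lra.
Qed.

(** * Analytic functions and Schwarz functions *)

Lemma sum_n_taylor (c : nat -> C) (u : C) (n : nat) :
  sum_n (fun k => c k * u ^ k)%C n = taylor c n u.
Proof.
  induction n as [|n IH].
  - rewrite sum_O. simpl. ring.
  - rewrite sum_Sn, IH. reflexivity.
Qed.

Lemma taylor_tail_le (c : nat -> C) (M s : R) (n : nat) (u : C) :
  0 <= M -> 0 < s -> (forall k, Cmod (c k) * s ^ k <= M) -> Cmod u <= s / 2 ->
  forall m, (n <= m)%nat ->
  Cmod (taylor c m u - taylor c n u) <= 2 * M * (Cmod u / s) ^ S n.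
Proof.
  intros HM Hs Hc Hu.
  set (q := Cmod u / s).
  assert (Hq0 : 0 <= q) by (apply Rdiv_le_0_compat; [apply Cmod_ge_0|auto]).
  assert (Hq1 : q <= 1 / 2).
  { unfold q. apply Rmult_le_reg_r with s; [auto|].
    replace (Cmod u / s * s) with (Cmod u) by (field; lra). lra. }
  assert (Hterm : forall k, Cmod (c k * u ^ k) <= M * q ^ k).
  { intros k. rewrite Cmod_mult, Cmod_pow. unfold q, Rdiv.
    rewrite Rpow_mult_distr, pow_inv.
    replace (Cmod (c k) * Cmod u ^ k) with ((Cmod (c k) * s ^ k) * (Cmod u ^ k * / s ^ k))
      by (field; apply pow_nonzero; lra).
    apply Rmult_le_compat_r; [|apply Hc].
    apply Rmult_le_pos; [apply pow_le, Cmod_ge_0|].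
    apply Rlt_le, Rinv_0_lt_compat, pow_lt; auto. }
  intros m Hm.
  apply Rle_trans with (2 * M * q ^ S n - 2 * M * q ^ S m).
  - induction Hm as [|m Hm IH].
    + replace (taylor c n u - taylor c n u)%C with (RtoC 0) by ring. rewrite Cmod_0. lra.
    + cbn [taylor].
      replace (taylor c m u + c (S m) * u ^ S m - taylor c n u)%C
        with ((taylor c m u - taylor c n u) + c (S m) * u ^ S m)%C by ring.
      apply Rle_trans with (1 := Cmod_triangle _ _).
      pose proof (Hterm (S m)) as Ht.
      assert (Hqm : 0 <= q ^ S m) by (apply pow_le; auto).
      change (q ^ S (S m)) with (q * q ^ S m).
      assert (M * (q * q ^ S m) <= M * (1 / 2 * q ^ S m)).
      { apply Rmult_le_compat_l; auto. apply Rmult_le_compat_r; auto. }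
      lra.
  - assert (0 <= M * q ^ S m) by (apply Rmult_le_pos; auto; apply pow_le; auto). lra.
Qed.

Lemma is_series_eventually (a : nat -> C) (l : C) (eps : R) :
  @is_series C_AbsRing C_NormedModule a l -> 0 < eps ->
  exists N, forall n, (N <= n)%nat -> Cmod (sum_n a n - l) < eps.
Proof.
  intros H He.
  destruct (proj1 (@filterlim_locally_ball_norm C_AbsRing nat C_NormedModule _ _ _ _) H
    (mkposreal eps He)) as [N HN].
  exists N. intros n Hn. apply (HN n Hn).
Qed.

Lemma series_jet (c : nat -> C) (F : C -> C) (r : R) (n : nat) :
  0 < r ->
  (forall u, Cmod u < r ->
     @is_series C_AbsRing C_NormedModule (fun k => c k * u ^ k)%C (F u)) ->
  jet n F c.
Proof.
  intros Hr H. set (s := r / 2).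
  assert (Hs : Cmod (RtoC s) = s) by (unfold s; rewrite Cmod_R, Rabs_pos_eq; lra).
  assert (Hb : exists M, 0 <= M /\ forall k, Cmod (c k) * s ^ k <= M).
  { destruct (is_series_eventually _ _ 1 (H s ltac:(unfold s in *; lra)) ltac:(lra))
      as [N HN].
    assert (Hfin : exists M, 0 <= M /\ forall k, (k <= N)%nat -> Cmod (c k) * s ^ k <= M).
    { clear HN. induction N as [|N [M [HM IH]]].
      - exists (Cmod (c O)). split; [apply Cmod_ge_0|]. intros k Hk.
        replace k with O by lia. simpl. lra.
      - exists (Rmax M (Cmod (c (S N)) * s ^ S N)).
        split; [apply Rle_trans with (1 := HM), Rmax_l|]. intros k Hk.
        destruct (Nat.eq_dec k (S N)) as [->|Hne]; [apply Rmax_r|].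
        apply Rle_trans with (2 := Rmax_l _ _). apply IH. lia. }
    destruct Hfin as [M [HM HMk]]. exists (Rmax M 2).
    split; [apply Rle_trans with (1 := HM), Rmax_l|]. intros k.
    destruct (Nat.le_gt_cases k N) as [Hk|Hk].
    - apply Rle_trans with (2 := Rmax_l _ _). auto.
    - apply Rle_trans with (2 := Rmax_r _ _). destruct k as [|k]; [lia|].
      pose proof (HN (S k) ltac:(lia)) as H1. pose proof (HN k ltac:(lia)) as H2.
      rewrite sum_n_taylor in H1, H2. cbn [taylor] in H1.
      pose proof (Cmod_minus_le (taylor c k s + c (S k) * s ^ S k - F s)%C
        (taylor c k s - F s)%C) as H3.
      replace (taylor c k s + c (S k) * s ^ S k - F s - (taylor c k s - F s))%C
        with (c (S k) * s ^ S k)%C in H3 by ring.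
      rewrite Cmod_mult, Cmod_pow, Hs in H3. lra. }
  destruct Hb as [M [HM Hc]].
  assert (Hs0 : 0 < s) by (unfold s; lra).
  exists (2 * M / s ^ S n), (s / 2).
  assert (Hsn : 0 < s ^ S n) by (apply pow_lt; auto).
  split; [apply Rdiv_le_0_compat; lra|]. split; [lra|].
  intros u Hu. apply le_epsilon. intros eps He.
  destruct (is_series_eventually _ _ eps (H u ltac:(unfold s in *; lra)) He) as [N HN].
  set (m := Nat.max n N).
  specialize (HN m ltac:(lia)). rewrite sum_n_taylor in HN.
  pose proof (taylor_tail_le c M s n u HM Hs0 Hc ltac:(lra) m ltac:(lia)) as Ht.
  replace (F u - taylor c n u)%C
    with ((taylor c m u - taylor c n u) - (taylor c m u - F u))%C by ring.
  apply Rle_trans with (1 := Cmod_minus_le _ _).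
  unfold Rdiv in Ht. rewrite Rpow_mult_distr, pow_inv in Ht. unfold Rdiv. lra.
Qed.

Lemma analytic_jet (f : C -> C) (z0 : C) :
  analytic_on_disc f -> Cmod z0 < 1 ->
  exists c : nat -> C, forall n, jet n (fun u => f (z0 + u)%C) c.
Proof.
  intros Hf Hz. destruct (Hf z0 Hz) as [c [r [Hr H]]].
  exists c. intros n. apply series_jet with r; auto.
  intros u Hu. specialize (H u Hu). unfold is_pseries in H.
  apply is_series_ext with (2 := H). intros k.
  change (scal (pow_n u k) (c k)) with (Cmult (pow_n (K := C_Ring) u k) (c k)).
  replace (pow_n (K := C_Ring) u k) with (u ^ k)%C; [apply Cmult_comm|].
  clear. induction k as [|k IH]; [reflexivity|].
  simpl. rewrite IH. reflexivity.
Qed.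

Lemma analytic_jet_at_0 (f : C -> C) :
  analytic_on_disc f -> exists c : nat -> C, forall n, jet n f c.
Proof.
  intros Hf. destruct (analytic_jet f 0 Hf) as [c Hc]; [rewrite Cmod_0; lra|].
  exists c. intros n. apply jet_fun_ext with (2 := Hc n).
  intros u. now rewrite Cplus_0_l.
Qed.

Lemma analytic_smooth (f : C -> C) (z0 : C) :
  analytic_on_disc f -> Cmod z0 < 1 -> smooth_at f z0.
Proof. intros Hf Hz. destruct (analytic_jet f z0 Hf Hz) as [c Hc]. exists c. apply Hc. Qed.

Lemma smooth_at_taylor (c : nat -> C) (n : nat) (z0 : C) : smooth_at (taylor c n) z0.
Proof.
  induction n as [|n IH]; [apply (smooth_at_const (c O))|].
  apply (smooth_at_plus (taylor c n) (fun z => c (S n) * z ^ S n)%C); auto.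
  apply (smooth_at_mult (fun _ => c (S n)) (fun z => z ^ S n)%C); [apply smooth_at_const|].
  apply smooth_at_pow, smooth_at_id.
Qed.

Lemma jet_taylor (c : nat -> C) (n m : nat) :
  (n <= m)%nat -> (forall k, (n < k)%nat -> c k = 0) -> jet m (taylor c n) c.
Proof.
  intros Hnm Hc. apply big_O_ext with (fun _ => RtoC 0); [|apply big_O_zero].
  intros u. induction Hnm as [|m Hnm IH].
  - ring.
  - cbn [taylor]. rewrite (Hc (S m)) by lia.
    transitivity (taylor c n u - taylor c m u)%C; [exact IH|ring].
Qed.

Definition schwarz (w : C -> C) : Prop :=
  analytic_on_disc w /\ w 0 = 0 /\ forall z, Cmod z < 1 -> Cmod (w z) < 1.

Definition seq4 (y0 y1 y2 y3 : C) (k : nat) : C :=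
  match k with O => y0 | 1%nat => y1 | 2%nat => y2 | 3%nat => y3 | _ => 0 end.

(** On a circle about the origin the product of [w] with the cubic polynomial of
    coefficients [y0], ..., [y3] is dominated by that polynomial, whose mean square is
    explicit; [coefficient_l2_bound] applies, and the radius tends to [1]. *)
Lemma schwarz_contraction (w : C -> C) (c : nat -> C) (y0 y1 y2 y3 : C) :
  schwarz w -> (forall n, jet n w c) ->
  Cmod (c 1%nat * y0) ^ 2
  + Cmod (c 2%nat * y0 + c 1%nat * y1) ^ 2
  + Cmod (c 3%nat * y0 + c 2%nat * y1 + c 1%nat * y2) ^ 2
  + Cmod (c 4%nat * y0 + c 3%nat * y1 + c 2%nat * y2 + c 1%nat * y3) ^ 2
  <= Cmod y0 ^ 2 + Cmod y1 ^ 2 + Cmod y2 ^ 2 + Cmod y3 ^ 2.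
Proof.
  intros [Hw [Hw0 Hw1]] HJ.
  assert (Hc0 : c O = 0) by (rewrite <- (jet_value _ _ _ (HJ O)); auto).
  set (y := seq4 y0 y1 y2 y3).
  set (h := fun z => (w z * taylor y 3 z)%C).
  set (b := conv c y).
  assert (Hb : forall k, (k <= 4)%nat -> b k = match k with
     | O => RtoC 0 | 1%nat => c 1%nat * y0 | 2%nat => c 2%nat * y0 + c 1%nat * y1
     | 3%nat => c 3%nat * y0 + c 2%nat * y1 + c 1%nat * y2
     | _ => c 4%nat * y0 + c 3%nat * y1 + c 2%nat * y2 + c 1%nat * y3 end%C).
  { intros k Hk. unfold b.
    do 5 (destruct k as [|k]; [simpl; rewrite Hc0; unfold y; simpl; ring|]). lia. }
  assert (HJh : jet 6 h b).
  { apply jet_mult; [apply HJ|]. apply jet_taylor; [lia|].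
    intros k Hk. do 4 (destruct k as [|k]; [lia|]). reflexivity. }
  set (S0 := Cmod y0 ^ 2). set (S1 := Cmod y1 ^ 2).
  set (S2 := Cmod y2 ^ 2). set (S3 := Cmod y3 ^ 2).
  assert (Hr : forall r, 0 < r < 1 ->
     Cmod (b 1%nat) ^ 2 * r ^ 2 + Cmod (b 2%nat) ^ 2 * r ^ 4
     + Cmod (b 3%nat) ^ 2 * r ^ 6 + Cmod (b 4%nat) ^ 2 * r ^ 8
     <= S0 + S1 * r ^ 2 + S2 * r ^ 4 + S3 * r ^ 6).
  { intros r Hr. apply (coefficient_l2_bound h b r); auto; [lra| | |].
    - intros z Hz. apply smooth_at_mult; [apply analytic_smooth; auto; lra|].
      apply smooth_at_taylor.
    - apply (Hb O). lia.
    - intros z Hz.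
      assert (Hi : Cmod (Ci * z) = r) by (rewrite Cmod_mult, Cmod_Ci; lra).
      assert (Hm : Cmod (- (1) * z) = r) by (rewrite Cmod_mult, Cmod_m1; lra).
      assert (Hmi : Cmod (- Ci * z) = r) by (rewrite Cmod_mult, Cmod_opp, Cmod_Ci; lra).
      assert (Hh : forall x, Cmod x = r -> Cmod (h x) ^ 2 <= Cmod (taylor y 3 x) ^ 2).
      { intros x Hx. apply pow_incr. split; [apply Cmod_ge_0|]. unfold h.
        rewrite Cmod_mult. specialize (Hw1 x ltac:(lra)).
        pose proof (Cmod_ge_0 (taylor y 3 x)). pose proof (Cmod_ge_0 (w x)). nra. }
      pose proof (Hh z Hz) as H1. pose proof (Hh _ Hi) as H2.
      pose proof (Hh _ Hm) as H3. pose proof (Hh _ Hmi) as H4.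
      assert (Hp : Cmod (taylor y 3 z) ^ 2 + Cmod (taylor y 3 (Ci * z)%C) ^ 2
        + Cmod (taylor y 3 (- (1) * z)%C) ^ 2 + Cmod (taylor y 3 (- Ci * z)%C) ^ 2
        = 4 * (S0 + S1 * r ^ 2 + S2 * r ^ 4 + S3 * r ^ 6)).
      { replace (S1 * r ^ 2) with (Cmod (y1 * z) ^ 2)
          by (rewrite Cmod_mult, Hz; unfold S1; ring).
        replace (S2 * r ^ 4) with (Cmod (y2 * z ^ 2) ^ 2)
          by (rewrite Cmod_mult, Cmod_pow, Hz; unfold S2; ring).
        replace (S3 * r ^ 6) with (Cmod (y3 * z ^ 3) ^ 2)
          by (rewrite Cmod_mult, Cmod_pow, Hz; unfold S3; ring).
        unfold S0, y. simpl taylor.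
        assert (E1 : (y0 + y1 * (Ci * z * 1) + y2 * (Ci * z * (Ci * z * 1))
           + y3 * (Ci * z * (Ci * z * (Ci * z * 1))) =
           y0 + Ci * (y1 * z) - (y2 * z ^ 2) - Ci * (y3 * z ^ 3))%C).
        { transitivity (y0 + Ci * (y1 * z) + (Ci * Ci) * (y2 * z ^ 2)
            + (Ci * Ci) * Ci * (y3 * z ^ 3))%C; [ring|]. rewrite Ci_sqr. ring. }
        assert (E2 : (y0 + y1 * (- Ci * z * 1) + y2 * (- Ci * z * (- Ci * z * 1))
           + y3 * (- Ci * z * (- Ci * z * (- Ci * z * 1))) =
           y0 - Ci * (y1 * z) - (y2 * z ^ 2) + Ci * (y3 * z ^ 3))%C).
        { transitivity (y0 - Ci * (y1 * z) + (Ci * Ci) * (y2 * z ^ 2)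
            - (Ci * Ci) * Ci * (y3 * z ^ 3))%C; [ring|]. rewrite Ci_sqr. ring. }
        assert (E3 : (y0 + y1 * (- (1) * z * 1) + y2 * (- (1) * z * (- (1) * z * 1))
           + y3 * (- (1) * z * (- (1) * z * (- (1) * z * 1))) =
           y0 - (y1 * z) + (y2 * z ^ 2) - (y3 * z ^ 3))%C) by ring.
        assert (E0 : (y0 + y1 * (z * 1) + y2 * (z * (z * 1)) + y3 * (z * (z * (z * 1)))
           = y0 + (y1 * z) + (y2 * z ^ 2) + (y3 * z ^ 3))%C) by ring.
        rewrite E0, E1, E2, E3. rewrite !Cmod2_alt.
        destruct (y1 * z)%C as [p1 p2], (y2 * z ^ 2)%C as [q1 q2],
          (y3 * z ^ 3)%C as [t1 t2], y0 as [v1 v2].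
        unfold Re, Im, Ci, Cminus, Cplus, Copp, Cmult, RtoC. simpl. ring. }
      lra. }
  rewrite !Hb in Hr by lia.
  set (B1 := Cmod (c 1%nat * y0) ^ 2) in *.
  set (B2 := Cmod (c 2%nat * y0 + c 1%nat * y1) ^ 2) in *.
  set (B3 := Cmod (c 3%nat * y0 + c 2%nat * y1 + c 1%nat * y2) ^ 2) in *.
  set (B4 := Cmod (c 4%nat * y0 + c 3%nat * y1 + c 2%nat * y2 + c 1%nat * y3) ^ 2) in *.
  assert (HB : 0 <= B1 /\ 0 <= B2 /\ 0 <= B3 /\ 0 <= B4)
    by (repeat split; apply pow2_ge_0).
  assert (HS : 0 <= S1 /\ 0 <= S2 /\ 0 <= S3) by (repeat split; apply pow2_ge_0).
  apply le_epsilon. intros eps He.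
  (* Bernoulli: 1 - 8 t <= (1 - t)^8 *)
  set (t := Rmin (1 / 2) (eps / (8 * (B1 + B2 + B3 + B4) + 1))).
  assert (Ht0 : 0 < t) by (apply Rmin_pos; [lra|apply Rdiv_lt_0_compat; lra]).
  assert (Ht1 : t <= 1 / 2) by apply Rmin_l.
  assert (Ht2 : t * (8 * (B1 + B2 + B3 + B4) + 1) <= eps).
  { apply Rle_trans with (eps / (8 * (B1 + B2 + B3 + B4) + 1)
      * (8 * (B1 + B2 + B3 + B4) + 1)).
    - apply Rmult_le_compat_r; [lra|]. apply Rmin_r.
    - right. field. lra. }
  specialize (Hr (1 - t) ltac:(lra)).
  assert (Hp : forall n, (n <= 8)%nat -> 1 - 8 * t <= (1 - t) ^ n <= 1).
  { intros n Hn.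
    assert (Hge : 1 - INR n * t <= (1 - t) ^ n).
    { clear Hn. induction n as [|n IH]; [simpl; lra|].
      rewrite S_INR. simpl pow. pose proof (pos_INR n).
      assert (0 <= (1 - t) ^ n) by (apply pow_le; lra).
      assert ((1 - t) * (1 - INR n * t) <= (1 - t) * (1 - t) ^ n)
        by (apply Rmult_le_compat_l; lra). nra. }
    split.
    - apply le_INR in Hn. replace (INR 8) with 8 in Hn by (simpl; ring). nra.
    - pose proof (pow_incr (1 - t) 1 n ltac:(lra)) as Hi. rewrite pow1 in Hi. exact Hi. }
  pose proof (Hp 2%nat ltac:(lia)) as P2. pose proof (Hp 4%nat ltac:(lia)) as P4.
  pose proof (Hp 6%nat ltac:(lia)) as P6. pose proof (Hp 8%nat ltac:(lia)) as P8.
  set (r2 := (1 - t) ^ 2) in *. clearbody r2.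
  set (r4 := (1 - t) ^ 4) in *. clearbody r4.
  set (r6 := (1 - t) ^ 6) in *. clearbody r6.
  set (r8 := (1 - t) ^ 8) in *. clearbody r8.
  assert (B1 * (1 - 8 * t) <= B1 * r2) by (apply Rmult_le_compat_l; lra).
  assert (B2 * (1 - 8 * t) <= B2 * r4) by (apply Rmult_le_compat_l; lra).
  assert (B3 * (1 - 8 * t) <= B3 * r6) by (apply Rmult_le_compat_l; lra).
  assert (B4 * (1 - 8 * t) <= B4 * r8) by (apply Rmult_le_compat_l; lra).
  assert (S1 * r2 <= S1 * 1) by (apply Rmult_le_compat_l; lra).
  assert (S2 * r4 <= S2 * 1) by (apply Rmult_le_compat_l; lra).
  assert (S3 * r6 <= S3 * 1) by (apply Rmult_le_compat_l; lra).
  lra.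
Qed.

Lemma polar_decomposition (x : C) : exists e : C, Cmod e = 1 /\ x = (Cmod x * e)%C.
Proof.
  destruct (Ceq_dec x 0) as [->|Hx].
  - exists 1. rewrite Cmod_1, Cmod_0. split; [auto|ring].
  - assert (Hm := proj1 (Cmod_gt_0 x) Hx).
    assert (Hr : RtoC (Cmod x) <> 0) by (apply Cmod_gt_0; rewrite Cmod_R, Rabs_pos_eq; lra).
    exists (x / Cmod x)%C. split; [|field; auto].
    rewrite Cmod_div, Cmod_R, Rabs_pos_eq by (auto; lra). field. lra.
Qed.

Lemma schwarz_c2_le (w : C -> C) (c : nat -> C) :
  schwarz w -> (forall n, jet n w c) -> Cmod (c 2%nat) <= 1 - Cmod (c 1%nat) ^ 2.
Proof.
  intros Hw HJ.
  destruct (polar_decomposition (c 2%nat)) as [e [He Hc]].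
  assert (H := schwarz_contraction w c 1 (e * Cconj (c 1%nat)) 0 0 Hw HJ).
  set (T := Cmod (c 1%nat) ^ 2) in *.
  assert (HT : 0 <= T) by apply pow2_ge_0.
  assert (E1 : Cmod (c 1%nat * 1) ^ 2 = T) by (rewrite Cmult_1_r; reflexivity).
  assert (E2 : Cmod (c 2%nat * 1 + c 1%nat * (e * Cconj (c 1%nat))) ^ 2
     = (Cmod (c 2%nat) + T) ^ 2).
  { replace (c 2%nat * 1 + c 1%nat * (e * Cconj (c 1%nat)))%C
      with (RtoC (Cmod (c 2%nat) + T) * e)%C.
    - rewrite Cmod_mult, He, Cmod_R, Rabs_pos_eq; [ring|].
      pose proof (Cmod_ge_0 (c 2%nat)). lra.
    - transitivity (Cmod (c 2%nat) * e + e * (c 1%nat * Cconj (c 1%nat)))%C.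
      + rewrite <- Cmod2_conj, RtoC_plus. fold T. ring.
      + rewrite <- Hc. ring. }
  rewrite E1, E2, Cmod_mult, Cmod_conj, He, Cmod_1, Cmod_0, Rmult_1_l in H. fold T in H.
  pose proof (pow2_ge_0 (Cmod (c 3%nat * 1 + c 2%nat * (e * Cconj (c 1%nat)) + c 1%nat * 0))).
  pose proof (pow2_ge_0 (Cmod (c 4%nat * 1 + c 3%nat * (e * Cconj (c 1%nat)) + c 2%nat * 0
    + c 1%nat * 0))).
  pose proof (Cmod_ge_0 (c 2%nat)). nra.
Qed.

(** For [al = 0] this is Carlson's inequality [|c4| <= 1 - |c1|^2 - |c2|^2]. With
    [A = 1 + al z], the left-hand side is the modulus of the coefficient of [z^4] in
    [A^2 w], and [d0 = c1], [d1 = c2 + al c1] are the first coefficients of [A w].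
    Multiplying [w] by [A + e (conj d1 z^2 + conj d0 z^3)] with a suitable phase [e]
    makes that modulus, [|d0|^2] and [|d1|^2] add up in one linear combination of the third
    and fourth coefficients of the product. *)
Lemma schwarz_c4_le (w : C -> C) (c : nat -> C) (al : C) :
  schwarz w -> (forall n, jet n w c) ->
  Cmod (c 4%nat + 2 * al * c 3%nat + al ^ 2 * c 2%nat)
  <= 1 + Cmod al ^ 2 - Cmod (c 1%nat) ^ 2 - Cmod (c 2%nat + al * c 1%nat) ^ 2.
Proof.
  intros Hw HJ.
  set (Q := (c 4%nat + 2 * al * c 3%nat + al ^ 2 * c 2%nat)%C).
  set (d0 := c 1%nat). set (d1 := (c 2%nat + al * d0)%C).
  destruct (polar_decomposition Q) as [e [He HQ]].
  assert (H := schwarz_contraction w c 1 al (e * Cconj d1) (e * Cconj d0) Hw HJ).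
  set (o3 := (c 3%nat * 1 + c 2%nat * al + c 1%nat * (e * Cconj d1))%C) in H.
  set (o4 := (c 4%nat * 1 + c 3%nat * al + c 2%nat * (e * Cconj d1)
    + c 1%nat * (e * Cconj d0))%C) in H.
  set (N := Cmod d0 ^ 2 + Cmod d1 ^ 2).
  assert (HN : 0 <= N) by (unfold N; pose proof (pow2_ge_0 (Cmod d0));
    pose proof (pow2_ge_0 (Cmod d1)); lra).
  assert (E : Cmod (o4 + al * o3) = Cmod Q + N).
  { replace (o4 + al * o3)%C with (RtoC (Cmod Q + N) * e)%C.
    - rewrite Cmod_mult, He, Cmod_R, Rabs_pos_eq; [ring|].
      pose proof (Cmod_ge_0 Q). lra.
    - transitivity (Cmod Q * e + e * (d0 * Cconj d0 + d1 * Cconj d1))%C.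
      + rewrite <- !Cmod2_conj. unfold N. rewrite !RtoC_plus. ring.
      + rewrite <- HQ. unfold Q, o4, o3, d1, d0. ring. }
  assert (E1 : Cmod (c 1%nat * 1) = Cmod d0) by (rewrite Cmult_1_r; reflexivity).
  assert (E2 : Cmod (c 2%nat * 1 + c 1%nat * al) = Cmod d1).
  { f_equal. unfold d1, d0. ring. }
  rewrite E1, E2, !Cmod_mult, !Cmod_conj, He, Cmod_1 in H.
  assert (Htri : Cmod Q + N <= Cmod o4 + Cmod al * Cmod o3).
  { rewrite <- E, <- Cmod_mult. apply Cmod_triangle. }
  pose proof (Cmod_ge_0 Q). pose proof (Cmod_ge_0 al).
  pose proof (Cmod_ge_0 o3). pose proof (Cmod_ge_0 o4).
  assert (Hcs : (Cmod o4 + Cmod al * Cmod o3) ^ 2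
     <= (1 + Cmod al ^ 2) * (Cmod o4 ^ 2 + Cmod o3 ^ 2)).
  { pose proof (pow2_ge_0 (Cmod o3 - Cmod al * Cmod o4)). nra. }
  assert (Hs : Cmod o4 ^ 2 + Cmod o3 ^ 2 <= 1 + Cmod al ^ 2) by nra.
  assert (Hfin : (Cmod Q + N) ^ 2 <= (1 + Cmod al ^ 2) ^ 2).
  { apply Rle_trans with ((Cmod o4 + Cmod al * Cmod o3) ^ 2);
      [apply pow_incr; lra|nra]. }
  assert (Hlin : Cmod Q + N <= 1 + Cmod al ^ 2).
  { apply Rnot_lt_le. intros Hlt. nra. }
  unfold N in Hlin. lra.
Qed.

(** * Derivatives of jets *)

Lemma jet_is_derive (F : C -> C) (z0 : C) (d : nat -> C) :
  jet 1 (fun u => F (z0 + u)%C) d ->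
  @is_derive C_AbsRing C_NormedModule F z0 (d 1%nat).
Proof.
  intros HJ. assert (Hv := jet_value _ _ _ HJ). simpl in Hv. rewrite Cplus_0_r in Hv.
  destruct HJ as [K [r [HK [Hr H]]]].
  split; [apply is_linear_scal_l|].
  intros x Hx.
  rewrite <- (@is_filter_lim_locally_unique C_AbsRing (AbsRing_NormedModule C_AbsRing)
    z0 x Hx).
  intros eps. apply (@locally_le_locally_norm C_AbsRing (AbsRing_NormedModule C_AbsRing)).
  assert (Hp : 0 < Rmin r (eps / (K + 1))).
  { apply Rmin_pos; [auto|]. apply Rdiv_lt_0_compat; [apply cond_pos|lra]. }
  assert (Hmain : forall y : C, Cmod (y - z0) < Rmin r (eps / (K + 1)) ->
    Cmod (F y - F z0 - (y - z0) * d 1%nat) <= eps * Cmod (y - z0)).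
  2:{ exists (mkposreal _ Hp). exact Hmain. }
  intros y Hy.
  assert (Hy1 := Rlt_le_trans _ _ _ Hy (Rmin_l _ _)).
  assert (Hy2 := Rlt_le_trans _ _ _ Hy (Rmin_r _ _)).
  specialize (H (y - z0)%C Hy1). simpl taylor in H.
  replace (z0 + (y - z0))%C with y in H by ring. rewrite <- Hv in H.
  replace (F y - F z0 - (y - z0) * d 1%nat)%C
    with (F y - (F z0 + d 1%nat * ((y - z0) * 1)))%C by ring.
  apply Rle_trans with (1 := H).
  pose proof (Cmod_ge_0 (y - z0)).
  assert (K * Cmod (y - z0) <= eps).
  { apply Rle_trans with ((K + 1) * (eps / (K + 1))).
    - apply Rmult_le_compat; lra.
    - right. field. lra. }
  replace (K * Cmod (y - z0) ^ 2) with (K * Cmod (y - z0) * Cmod (y - z0)) by ring.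
  apply Rmult_le_compat_r; auto.
Qed.

Lemma jet_C_derive_value (F : C -> C) (z0 : C) (d : nat -> C) :
  jet 1 (fun u => F (z0 + u)%C) d -> C_derive F z0 = d 1%nat.
Proof. intros H. apply is_C_derive_unique, jet_is_derive, H. Qed.

Lemma cauchy_estimate (F : C -> C) (z0 : C) (d : nat -> C) (s M : R) :
  0 < s -> (forall z, Cmod (z - z0) <= s -> smooth_at F z) ->
  (forall z, Cmod (z - z0) <= s -> Cmod (F z) <= M) ->
  jet 6 (fun u => F (z0 + u)%C) d ->
  Cmod (d 1%nat) * s <= M.
Proof.
  intros Hs Hsm HM HJ.
  assert (Hin : forall z, Cmod z <= 1 -> Cmod (z0 + s * z - z0) <= s).
  { intros z Hz. replace (z0 + s * z - z0)%C with (s * z)%C by ring.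
    rewrite Cmod_mult, Cmod_R, Rabs_pos_eq by lra. nra. }
  (* the factor z provides the zero at the origin and shifts the indices by one *)
  set (h := fun z => (z * F (z0 + s * z))%C).
  set (b := conv (fun k => match k with 1%nat => RtoC 1 | _ => RtoC 0 end)
    (fun k => s ^ k * d k)%C).
  assert (H := coefficient_l2_bound h b 1 (M ^ 2)).
  assert (Hb2 : b 2%nat = (s * d 1%nat)%C) by (unfold b; simpl; ring).
  assert (HM0 : 0 <= M).
  { apply Rle_trans with (2 := HM (z0 + s * 0)%C (Hin 0 ltac:(rewrite Cmod_0; lra))).
    apply Cmod_ge_0. }
  rewrite Hb2, Cmod_mult, Cmod_R, Rabs_pos_eq in H by lra.
  assert (H' : Cmod (b 1%nat) ^ 2 * 1 ^ 2 + (s * Cmod (d 1%nat)) ^ 2 * 1 ^ 4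
    + Cmod (b 3%nat) ^ 2 * 1 ^ 6 + Cmod (b 4%nat) ^ 2 * 1 ^ 8 <= M ^ 2).
  { apply H; [lra| | | |].
    - intros z Hz. apply smooth_at_mult; [apply smooth_at_id|].
      apply (smooth_at_dilate (fun x => F (z0 + x)%C) s).
      destruct (Hsm _ (Hin z Hz)) as [c Hc]. exists c.
      apply jet_fun_ext with (2 := Hc). intros u. f_equal. ring.
    - apply jet_mult; [apply jet_id|]. apply (jet_dilate 6 s _ _ HJ).
    - unfold b. simpl. ring.
    - intros z Hz.
      assert (Hq : forall x, Cmod x = 1 -> Cmod (h x) ^ 2 <= M ^ 2).
      { intros x Hx. apply pow_incr. split; [apply Cmod_ge_0|]. unfold h.
        rewrite Cmod_mult, Hx, Rmult_1_l. apply HM, Hin. lra. }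
      pose proof (Hq z Hz). pose proof (Hq (Ci * z)%C).
      pose proof (Hq (- (1) * z)%C). pose proof (Hq (- Ci * z)%C).
      rewrite !Cmod_mult, ?Cmod_opp, ?Cmod_Ci, ?Cmod_1, ?Hz, ?Rmult_1_l in *. lra. }
  pose proof (pow2_ge_0 (Cmod (b 1%nat))). pose proof (pow2_ge_0 (Cmod (b 3%nat))).
  pose proof (pow2_ge_0 (Cmod (b 4%nat))). pose proof (Cmod_ge_0 (d 1%nat)).
  rewrite !pow1 in H'. apply Rnot_lt_le. intros Hlt. nra.
Qed.

Lemma jet_pow_at (z : C) (k : nat) :
  exists d : nat -> C, (forall m, jet m (fun u => (z + u) ^ k)%C d)
    /\ d O = (z ^ k)%C /\ d 1%nat = (INR k * z ^ (k - 1))%C.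
Proof.
  induction k as [|k [d [HJ [H0 H1]]]].
  - exists (fun k => match k with O => RtoC 1 | _ => RtoC 0 end).
    split; [intros m; apply (jet_const m 1)|]. split; simpl; [auto|ring].
  - eexists. split; [|split].
    + intros m. apply (jet_mult m (fun u => z + u)%C (fun u => (z + u) ^ k)%C); [|apply HJ].
      apply jet_plus; [apply jet_const|apply jet_id].
    + simpl. rewrite H0. ring.
    + change (((z + 0) * d 1%nat + (0 + 1) * d O)%C = (INR (S k) * z ^ (S k - 1))%C).
      rewrite H0, H1, S_INR, RtoC_plus. replace (S k - 1)%nat with k by lia.
      destruct k as [|k]; [simpl; ring|].
      replace (S k - 1)%nat with k by lia. rewrite Cpow_S. ring.
Qed.

Lemma jet_taylor_at (c : nat -> C) (n : nat) (z : C) :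
  exists d : nat -> C, (forall m, jet m (fun u => taylor c (S n) (z + u)%C) d)
    /\ d 1%nat = taylor (fun k => INR (S k) * c (S k))%C n z.
Proof.
  assert (Hmon : forall k, exists d, (forall m, jet m (fun u => c k * (z + u) ^ k)%C d)
    /\ d 1%nat = (INR k * c k * z ^ (k - 1))%C).
  { intros k. destruct (jet_pow_at z k) as [d [HJ [_ H1]]].
    exists (fun i => c k * d i)%C. split; [intros m; apply jet_scal, HJ|].
    rewrite H1. ring. }
  induction n as [|n [d [HJ H1]]].
  - destruct (Hmon 1%nat) as [d [HJ H1]].
    exists (fun k => (match k with O => c O | _ => RtoC 0 end) + d k)%C.
    split; [|simpl in *; rewrite H1; ring].
    intros m. apply (jet_plus m (fun _ => c O) (fun u => c 1%nat * (z + u) ^ 1)%C);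
      [apply jet_const|apply HJ].
  - destruct (Hmon (S (S n))) as [e [HK K1]].
    exists (fun k => d k + e k)%C. split.
    + intros m. apply (jet_plus m (fun u => taylor c (S n) (z + u)%C)
        (fun u => c (S (S n)) * (z + u) ^ S (S n))%C); auto.
    + rewrite H1, K1. simpl taylor. replace (S (S n) - 1)%nat with (S n) by lia.
      reflexivity.
Qed.

(** Term-by-term differentiation: the remainder [f - P] is [O(u^(n+2))], and
    Cauchy's estimate on the disc of radius [|z|/2] about [z] costs one power. *)
Lemma jet_C_derive (f : C -> C) (A : nat -> C) (n : nat) :
  analytic_on_disc f -> jet (S n) f A ->
  jet n (C_derive f) (fun k => INR (S k) * A (S k))%C.
Proof.
  intros Hf HJ.
  destruct HJ as [K [r [HK [Hr HR]]]].
  exists (2 * K * (3 / 2) ^ S (S n)), (Rmin (r / 2) (1 / 2)).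
  assert (H32 : 0 < (3 / 2) ^ S (S n)) by (apply pow_lt; lra).
  split; [nra|]. split; [apply Rmin_pos; lra|].
  intros z Hz.
  assert (Hz1 := Rlt_le_trans _ _ _ Hz (Rmin_l _ _)).
  assert (Hz2 := Rlt_le_trans _ _ _ Hz (Rmin_r _ _)).
  destruct (analytic_jet f z Hf ltac:(lra)) as [d Hd].
  destruct (jet_taylor_at A n z) as [e [He He1]].
  rewrite (jet_C_derive_value f z d (Hd 1%nat)), <- He1.
  destruct (Ceq_dec z 0) as [->|Hz0].
  - (* at the origin the two linear coefficients agree by uniqueness *)
    assert (E : d 1%nat = e 1%nat).
    { rewrite He1, taylor_at_0. transitivity (A 1%nat); [|simpl; ring].
      apply (jet_unique 1 f d A); [| |lia].
      - apply jet_fun_ext with (2 := Hd 1%nat). intros u. now rewrite Cplus_0_l.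
      - apply (jet_le 1 (S n)); [lia|]. exists K, r. auto. }
    rewrite E. replace (e 1%nat - e 1%nat)%C with (RtoC 0) by ring. rewrite Cmod_0.
    rewrite pow_ne_zero by lia. lra.
  - apply Cmod_gt_0 in Hz0.
    assert (Hin : forall x, Cmod (x - z) <= Cmod z / 2 -> Cmod x <= 3 / 2 * Cmod z).
    { intros x Hx. replace x with ((x - z) + z)%C by ring.
      apply Rle_trans with (1 := Cmod_triangle _ _). lra. }
    assert (HC := cauchy_estimate (fun x => f x - taylor A (S n) x)%C z
      (fun k => d k - e k)%C (Cmod z / 2) (K * (3 / 2 * Cmod z) ^ S (S n))).
    assert (HC' : Cmod (d 1%nat - e 1%nat) * (Cmod z / 2)
      <= K * (3 / 2 * Cmod z) ^ S (S n)).
    { apply HC; [lra| | |].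
      - intros x Hx. specialize (Hin x Hx).
        destruct (analytic_smooth f x Hf ltac:(lra)) as [c1 Hc1].
        destruct (smooth_at_taylor A (S n) x) as [c2 Hc2].
        exists (fun k => c1 k - c2 k)%C. apply jet_minus; auto.
      - intros x Hx. specialize (Hin x Hx).
        apply Rle_trans with (1 := HR x ltac:(lra)).
        apply Rmult_le_compat_l; auto. apply pow_incr. split; [apply Cmod_ge_0|auto].
      - apply jet_minus; [apply Hd|apply He]. }
    rewrite Rpow_mult_distr in HC'.
    apply Rmult_le_reg_r with (Cmod z / 2); [lra|].
    apply Rle_trans with (1 := HC'). right. simpl. field.
Qed.

(** * The Taylor jet of [((1 + w) / (1 - w)) ^ beta] *)

Definition has_derivative (phi : R -> C) (t : R) (l : C) : Prop :=
  is_derive (fun s => Re (phi s)) t (Re l) /\ is_derive (fun s => Im (phi s)) t (Im l).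

Lemma has_derivative_mult (phi psi : R -> C) (t : R) (l m : C) :
  has_derivative phi t l -> has_derivative psi t m ->
  has_derivative (fun s => phi s * psi s)%C t (l * psi t + phi t * m)%C.
Proof.
  intros [H1 H2] [H3 H4].
  set (p1 := fun s => Re (phi s)). set (p2 := fun s => Im (phi s)).
  change (is_derive p1 t (Re l)) in H1. change (is_derive p2 t (Im l)) in H2.
  set (q1 := fun s => Re (psi s)). set (q2 := fun s => Im (psi s)).
  change (is_derive q1 t (Re m)) in H3. change (is_derive q2 t (Im m)) in H4.
  split.
  - apply (is_derive_ext (fun s => p1 s * q1 s - p2 s * q2 s));
      [intros; reflexivity|].
    auto_derive; [repeat split; eexists; eassumption|].
    rewrite (is_derive_unique (fun x : R => p1 x) _ _ H1),
      (is_derive_unique (fun x : R => p2 x) _ _ H2),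
      (is_derive_unique (fun x : R => q1 x) _ _ H3), (is_derive_unique (fun x : R => q2 x) _ _ H4).
    unfold p1, p2, q1, q2.
    unfold Re, Im, Cplus, Cmult. simpl. ring.
  - apply (is_derive_ext (fun s => p1 s * q2 s + p2 s * q1 s));
      [intros; reflexivity|].
    auto_derive; [repeat split; eexists; eassumption|].
    rewrite (is_derive_unique (fun x : R => p1 x) _ _ H1),
      (is_derive_unique (fun x : R => p2 x) _ _ H2),
      (is_derive_unique (fun x : R => q1 x) _ _ H3), (is_derive_unique (fun x : R => q2 x) _ _ H4).
    unfold p1, p2, q1, q2.
    unfold Re, Im, Cplus, Cmult. simpl. ring.
Qed.

Lemma has_derivative_plus (phi psi : R -> C) (t : R) (l m : C) :
  has_derivative phi t l -> has_derivative psi t m ->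
  has_derivative (fun s => phi s + psi s)%C t (l + m)%C.
Proof.
  intros [H1 H2] [H3 H4]. split.
  - apply (is_derive_plus (fun s => Re (phi s)) (fun s => Re (psi s))); auto.
  - apply (is_derive_plus (fun s => Im (phi s)) (fun s => Im (psi s))); auto.
Qed.

Lemma has_derivative_const (a : C) (t : R) : has_derivative (fun _ => a) t 0.
Proof. split; apply (is_derive_const (K := R_AbsRing) (V := R_NormedModule)). Qed.

Lemma has_derivative_line (w : C) (t : R) : has_derivative (fun s => s * w)%C t w.
Proof.
  destruct w as [x y].
  split; unfold Re, Im, Cmult, RtoC; simpl; auto_derive; auto; ring.
Qed.

Lemma has_derivative_eq (phi : R -> C) (t : R) (l m : C) :
  has_derivative phi t l -> l = m -> has_derivative phi t m.
Proof. now intros H <-. Qed.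

Lemma has_derivative_taylor (c : nat -> C) (n : nat) (w : C) (t : R) :
  has_derivative (fun s => taylor c (S n) (s * w)%C) t
    (w * taylor (fun k => INR (S k) * c (S k)) n (t * w))%C.
Proof.
  assert (Hpow : forall k, has_derivative (fun s => (s * w) ^ S k)%C t
    (INR (S k) * (t * w) ^ k * w)%C).
  { induction k as [|k IH].
    - simpl. eapply has_derivative_eq.
      + apply has_derivative_mult; [apply has_derivative_line|apply has_derivative_const].
      + cbv beta. ring.
    - eapply has_derivative_eq.
      + apply (has_derivative_mult (fun s => s * w)%C (fun s => (s * w) ^ S k)%C);
          [apply has_derivative_line|apply IH].
      + rewrite (S_INR (S k)), RtoC_plus, Cpow_S. ring. }
  assert (Hmon : forall k, has_derivative (fun s => c (S k) * (s * w) ^ S k)%C t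
    (INR (S k) * c (S k) * (t * w) ^ k * w)%C).
  { intros k. eapply has_derivative_eq.
    - apply has_derivative_mult; [apply has_derivative_const|apply Hpow].
    - cbv beta. ring. }
  induction n as [|n IH].
  - eapply has_derivative_eq.
    + apply (has_derivative_plus (fun _ => c O) (fun s => c 1%nat * (s * w) ^ 1)%C);
        [apply has_derivative_const|apply Hmon].
    + simpl. ring.
  - eapply has_derivative_eq.
    + apply (has_derivative_plus (fun s => taylor c (S n) (s * w)%C)
        (fun s => c (S (S n)) * (s * w) ^ S (S n))%C); [apply IH|apply Hmon].
    + cbn [taylor]. cbv beta. ring.
Qed.

Lemma has_derivative_Cexp (phi : R -> C) (t : R) (l : C) :
  has_derivative phi t l -> has_derivative (fun s => Cexp (phi s)) t (l * Cexp (phi t))%C.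
Proof.
  intros [H1 H2].
  set (p1 := fun s => Re (phi s)). set (p2 := fun s => Im (phi s)).
  change (is_derive p1 t (Re l)) in H1. change (is_derive p2 t (Im l)) in H2.
  split.
  - apply (is_derive_ext (fun s => exp (p1 s) * cos (p2 s)));
      [intros; reflexivity|].
    auto_derive; [repeat split; eexists; eassumption|].
    rewrite (is_derive_unique (fun x : R => p1 x) _ _ H1),
      (is_derive_unique (fun x : R => p2 x) _ _ H2).
    unfold p1, p2.
    unfold Cexp, Re, Im, Cmult. simpl. ring.
  - apply (is_derive_ext (fun s => exp (p1 s) * sin (p2 s)));
      [intros; reflexivity|].
    auto_derive; [repeat split; eexists; eassumption|].
    rewrite (is_derive_unique (fun x : R => p1 x) _ _ H1),
      (is_derive_unique (fun x : R => p2 x) _ _ H2).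
    unfold p1, p2.
    unfold Cexp, Re, Im, Cmult. simpl. ring.
Qed.

Lemma Cexp_opp (z : C) : (Cexp (- z) * Cexp z = 1)%C.
Proof.
  destruct z as [x y]. unfold Cexp, Copp, Cmult, RtoC, Re, Im. simpl.
  rewrite cos_neg, sin_neg, exp_Ropp.
  assert (He := exp_pos x). assert (Ht := sin2_cos2 y). unfold Rsqr in Ht.
  f_equal.
  - transitivity (sin y * sin y + cos y * cos y); [field; lra|auto].
  - field. lra.
Qed.

Lemma Cmod_Cexp (z : C) : Cmod (Cexp z) = exp (Re z).
Proof.
  assert (Ht := sin2_cos2 (Im z)). unfold Rsqr in Ht. pose proof (exp_pos (Re z)).
  unfold Cmod, Cexp. simpl.
  replace (exp (Re z) * cos (Im z) * (exp (Re z) * cos (Im z) * 1)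
    + exp (Re z) * sin (Im z) * (exp (Re z) * sin (Im z) * 1))
    with (Rsqr (exp (Re z))).
  - rewrite sqrt_Rsqr; lra.
  - unfold Rsqr. transitivity (exp (Re z) * exp (Re z)
      * (sin (Im z) * sin (Im z) + cos (Im z) * cos (Im z))); [rewrite Ht; ring|ring].
Qed.

(** On the right half-plane the principal logarithm has this smooth expression,
    in which the argument is differentiable across the real axis. *)
Definition half_plane_log (z : C) : C :=
  (ln (Re z ^ 2 + Im z ^ 2) / 2, atan (Im z / Re z)).

Lemma Clog_half_plane (z : C) : 0 < Re z -> Clog z = half_plane_log z.
Proof.
  destruct z as [x y]. unfold Re, Im. simpl. intros Hx.
  assert (Hs : 0 < x * (x * 1) + y * (y * 1)) by nra.
  assert (Hcos : acos (x / Cmod (x, y)) = Rabs (atan (y / x))).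
  { assert (Hc : x / Cmod (x, y) = cos (atan (y / x))).
    { rewrite cos_atan. unfold Cmod. simpl.
      replace (1 + Rsqr (y / x)) with ((x * (x * 1) + y * (y * 1)) / Rsqr x)
        by (unfold Rsqr; field; lra).
      assert (Hx2 : 0 < Rsqr x) by (apply Rlt_0_sqr; lra).
      rewrite sqrt_div_alt, sqrt_Rsqr by lra.
      pose proof (sqrt_lt_R0 _ Hs). field. lra. }
    rewrite Hc. pose proof (atan_bound (y / x)). pose proof PI_RGT_0.
    unfold Rabs. destruct (Rcase_abs (atan (y / x))).
    - rewrite <- cos_neg. apply acos_cos. lra.
    - apply acos_cos. lra. }
  unfold Clog, half_plane_log, Carg, Re, Im. simpl. f_equal.
  - unfold Cmod. simpl.
    assert (Hq := sqrt_lt_R0 _ Hs).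
    rewrite <- (sqrt_def (x * (x * 1) + y * (y * 1))) at 2 by lra.
    rewrite ln_mult by auto. field.
  - fold (Cmod (x, y)). rewrite Hcos.
    destruct (Rle_dec 0 y) as [Hy|Hy].
    + apply Rabs_pos_eq. rewrite <- atan_0.
      destruct Hy as [Hy|<-].
      * apply Rlt_le, atan_increasing. apply Rdiv_lt_0_compat; auto.
      * unfold Rdiv. rewrite Rmult_0_l. lra.
    + rewrite Rabs_left; [ring|]. rewrite <- atan_0. apply atan_increasing.
      apply Rmult_lt_reg_r with x; [auto|].
      replace (y / x * x) with y by (field; lra). lra.
Qed.

Lemma has_derivative_half_plane_log (phi : R -> C) (t : R) (l : C) :
  0 < Re (phi t) -> has_derivative phi t l ->
  has_derivative (fun s => half_plane_log (phi s)) t (l / phi t)%C.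
Proof.
  intros Hp [H1 H2].
  set (p1 := fun s => Re (phi s)). set (p2 := fun s => Im (phi s)).
  change (is_derive p1 t (Re l)) in H1. change (is_derive p2 t (Im l)) in H2.
  assert (Hp1 : 0 < p1 t) by exact Hp.
  assert (Hn : Re (phi t) ^ 2 + Im (phi t) ^ 2 <> 0) by nra.
  split.
  - apply (is_derive_ext (fun s => ln (p1 s ^ 2 + p2 s ^ 2) / 2));
      [intros; reflexivity|].
    auto_derive; [repeat split; try (eexists; eassumption); nra|].
    rewrite (is_derive_unique (fun x : R => p1 x) _ _ H1),
      (is_derive_unique (fun x : R => p2 x) _ _ H2).
    unfold p1, p2.
    destruct (phi t) as [x y]. unfold Re, Im, Cdiv, Cinv, Cmult in *. simpl in *.
    field. intros HH; nra.
  - apply (is_derive_ext (fun s => atan (p2 s / p1 s)));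
      [intros; reflexivity|].
    auto_derive; [repeat split; try (eexists; eassumption); lra|].
    rewrite (is_derive_unique (fun x : R => p1 x) _ _ H1),
      (is_derive_unique (fun x : R => p2 x) _ _ H2).
    unfold p1, p2.
    destruct (phi t) as [x y]. unfold Re, Im, Cdiv, Cinv, Cmult in *. simpl in *.
    field. repeat split; intros HH; nra.
Qed.

Lemma has_derivative_inv (phi : R -> C) (t : R) (l : C) :
  phi t <> 0 -> has_derivative phi t l ->
  has_derivative (fun s => / phi s)%C t (- l / (phi t * phi t))%C.
Proof.
  intros Hp [H1 H2].
  set (p1 := fun s => Re (phi s)). set (p2 := fun s => Im (phi s)).
  change (is_derive p1 t (Re l)) in H1. change (is_derive p2 t (Im l)) in H2.
  assert (Hn : Re (phi t) ^ 2 + Im (phi t) ^ 2 <> 0).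
  { intros E. apply Hp. destruct (phi t) as [x y]. unfold Re, Im in E. simpl in E.
    assert (x = 0) by nra. assert (y = 0) by nra. subst. reflexivity. }
  assert (Hn2 : (Re (phi t) * Re (phi t) - Im (phi t) * Im (phi t)) ^ 2
    + (Re (phi t) * Im (phi t) + Im (phi t) * Re (phi t)) ^ 2 <> 0).
  { replace ((Re (phi t) * Re (phi t) - Im (phi t) * Im (phi t)) ^ 2
      + (Re (phi t) * Im (phi t) + Im (phi t) * Re (phi t)) ^ 2)
      with ((Re (phi t) ^ 2 + Im (phi t) ^ 2) ^ 2) by ring.
    apply pow_nonzero; auto. }
  split.
  - apply (is_derive_ext (fun s => p1 s / (p1 s ^ 2 + p2 s ^ 2)));
      [intros; reflexivity|].
    auto_derive; [repeat split; try (eexists; eassumption); simpl in Hn; auto|].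
    rewrite (is_derive_unique (fun x : R => p1 x) _ _ H1),
      (is_derive_unique (fun x : R => p2 x) _ _ H2).
    unfold p1, p2.
    destruct (phi t) as [x y]. unfold Re, Im, Cdiv, Cinv, Cmult, Copp in *. simpl in *.
    field. split; intros HH; [apply Hn2; rewrite <- HH; ring|apply Hn; rewrite <- HH; ring].
  - apply (is_derive_ext (fun s => - p2 s / (p1 s ^ 2 + p2 s ^ 2)));
      [intros; reflexivity|].
    auto_derive; [repeat split; try (eexists; eassumption); simpl in Hn; auto|].
    rewrite (is_derive_unique (fun x : R => p1 x) _ _ H1),
      (is_derive_unique (fun x : R => p2 x) _ _ H2).
    unfold p1, p2.
    destruct (phi t) as [x y]. unfold Re, Im, Cdiv, Cinv, Cmult, Copp in *. simpl in *.
    field. split; intros HH; [apply Hn2; rewrite <- HH; ring|apply Hn; rewrite <- HH; ring].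
Qed.

Lemma mean_value_bound (phi dphi : R -> C) (M : R) :
  (forall t, 0 <= t <= 1 -> has_derivative phi t (dphi t)) ->
  (forall t, 0 <= t <= 1 -> Cmod (dphi t) <= M) ->
  Cmod (phi 1 - phi 0) <= 2 * M.
Proof.
  intros Hd HM.
  assert (Hmvt : forall (f df : R -> R), (forall t, 0 <= t <= 1 -> is_derive f t (df t)) ->
    (forall t, 0 <= t <= 1 -> Rabs (df t) <= M) -> Rabs (f 1 - f 0) <= M).
  { intros f df Hf Hb.
    destruct (MVT_gen f 0 1 df) as [c [Hc E]].
    - rewrite Rmin_left, Rmax_right by lra. intros x Hx. apply Hf. lra.
    - rewrite Rmin_left, Rmax_right by lra. intros x Hx.
      apply continuity_pt_filterlim.
      exact (ex_derive_continuous f x (ex_intro _ _ (Hf x Hx))).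
    - rewrite Rmin_left, Rmax_right in Hc by lra. rewrite E.
      replace (df c * (1 - 0)) with (df c) by ring. auto. }
  assert (H1 : Rabs (Re (phi 1) - Re (phi 0)) <= M).
  { apply (Hmvt (fun s => Re (phi s)) (fun s => Re (dphi s))).
    - intros t Ht. apply (Hd t Ht).
    - intros t Ht. apply Rle_trans with (2 := HM t Ht). apply re_le_Cmod. }
  assert (H2 : Rabs (Im (phi 1) - Im (phi 0)) <= M).
  { apply (Hmvt (fun s => Im (phi s)) (fun s => Im (dphi s))).
    - intros t Ht. apply (Hd t Ht).
    - intros t Ht. apply Rle_trans with (2 := HM t Ht).
      apply Rle_trans with (2 := Rmax_Cmod _). apply Rmax_r. }
  set (v := (phi 1 - phi 0)%C).
  change (Rabs (Re v) <= M) in H1. change (Rabs (Im v) <= M) in H2.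
  assert (Hv : Cmod v ^ 2 <= (2 * M) ^ 2).
  { rewrite Cmod2_alt, <- (pow2_abs (Re v)), <- (pow2_abs (Im v)).
    pose proof (Rabs_pos (Re v)). pose proof (Rabs_pos (Im v)). nra. }
  pose proof (Cmod_ge_0 v). pose proof (Rabs_pos (Re v)).
  apply Rnot_lt_le. intros Hlt. nra.
Qed.

Definition majorant_jet (beta : R) (k : nat) : C :=
  match k with
  | O => 1
  | 1%nat => 2 * beta
  | 2%nat => 2 * beta ^ 2
  | 3%nat => (4 * beta ^ 3 + 2 * beta) / 3
  | 4%nat => (2 * beta ^ 4 + 4 * beta ^ 2) / 3
  | _ => 0
  end%C.

Lemma cayley_bounds (u : C) : Cmod u <= 1 / 2 ->
  1 / 2 <= Cmod (1 + u) <= 3 / 2 /\ 1 / 2 <= Cmod (1 - u) <= 3 / 2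
  /\ 0 < Re ((1 + u) / (1 - u)) /\ 1 / 3 <= Cmod ((1 + u) / (1 - u)) <= 3.
Proof.
  intros Hu.
  assert (H1 := Cmod_triangle 1 u). assert (H2 := Cmod_minus_le 1 u).
  assert (H3 := Cmod_minus_le (1 + u)%C u). assert (H4 := Cmod_triangle (1 - u)%C u).
  replace (1 + u - u)%C with (RtoC 1) in H3 by ring.
  replace (1 - u + u)%C with (RtoC 1) in H4 by ring.
  rewrite Cmod_1 in *.
  assert (Hn : (1 - u)%C <> 0) by (apply Cmod_gt_0; lra).
  split; [lra|]. split; [lra|]. split.
  - assert (Hd : 0 < Cmod (1 - u) ^ 2) by (apply pow_lt; lra).
    assert (Hm : Cmod u ^ 2 < 1) by (pose proof (Cmod_ge_0 u); nra).
    rewrite Cmod2_alt in *. destruct u as [x y].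
    unfold Re, Im, Cdiv, Cinv, Cminus, Cplus, Copp, Cmult, RtoC in *. simpl in *.
    match goal with |- 0 < ?e => replace e with ((1 - (x ^ 2 + y ^ 2)) /
      ((1 + - x) * ((1 + - x) * 1) + (0 + - y) * ((0 + - y) * 1))) end.
    + apply Rdiv_lt_0_compat; [simpl; lra|auto].
    + field. lra.
  - rewrite Cmod_div by auto. split.
    + apply Rmult_le_reg_r with (Cmod (1 - u)); [lra|].
      replace (Cmod (1 + u) / Cmod (1 - u) * Cmod (1 - u)) with (Cmod (1 + u))
        by (field; lra). lra.
    + apply Rmult_le_reg_r with (Cmod (1 - u)); [lra|].
      replace (Cmod (1 + u) / Cmod (1 - u) * Cmod (1 - u)) with (Cmod (1 + u))
        by (field; lra). lra.
Qed.

Lemma Cmod_Cexp_log_le (beta sgn : R) (z : C) :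
  0 <= beta <= 1 -> (sgn = 1 \/ sgn = -1) -> 0 < Re z -> 1 / 3 <= Cmod z <= 3 ->
  Cmod (Cexp (sgn * beta * half_plane_log z)%C) <= 3.
Proof.
  intros Hb Hs Hre Hz.
  rewrite <- Clog_half_plane by auto. rewrite Cmod_Cexp.
  assert (Hln : - ln 3 <= ln (Cmod z) <= ln 3).
  { rewrite <- ln_Rinv by lra. replace (/ 3) with (1 / 3) by lra.
    split; apply ln_le; lra. }
  assert (Hl3 : 0 < ln 3) by (rewrite <- ln_1; apply ln_increasing; lra).
  rewrite <- (exp_ln 3) by lra.
  assert (E : Re (sgn * beta * Clog z)%C = sgn * (beta * ln (Cmod z))).
  { unfold Clog, Re, Cmult, RtoC. simpl. ring. }
  rewrite E.
  assert (Hle : sgn * (beta * ln (Cmod z)) <= ln 3).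
  { destruct Hs as [-> | ->]; nra. }
  destruct Hle as [Hlt|Heq]; [apply Rlt_le, exp_increasing; auto|rewrite Heq; lra].
Qed.

(** With [Q] the claimed Taylor polynomial, the product [Q(u) * ((1 - u) / (1 + u))^beta]
    has derivative [O(u^4)], because [Q] solves the differential equation
    [(1 - u^2) Q' = 2 beta Q] of the majorant up to [O(u^4)]; integrating along the
    segment from [0] to [w] gives the order of contact. *)
Lemma jet_majorant (beta : R) :
  0 <= beta <= 1 -> jet 4 (strongly_starlike_majorant beta) (majorant_jet beta).
Proof.
  intros Hb.
  set (Q := majorant_jet beta).
  set (e := (3 * Q 3%nat + 2 * beta * Q 4%nat)%C).
  set (M := 12 * (Cmod e + Cmod (4 * Q 4%nat))).
  assert (HM : 0 <= M).
  { unfold M. pose proof (Cmod_ge_0 e). pose proof (Cmod_ge_0 (4 * Q 4%nat)). lra. }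
  exists (6 * M), (1 / 2). split; [lra|]. split; [lra|].
  intros w Hw.
  set (zeta := fun t : R => ((1 + t * w) * / (1 - t * w))%C).
  set (E := fun t : R => Cexp ((-1) * beta * half_plane_log (zeta t))%C).
  set (phi := fun t : R => (taylor Q 4 (t * w) * E t)%C).
  assert (Hu : forall t, 0 <= t <= 1 -> Cmod (t * w) <= Cmod w).
  { intros t Ht. rewrite Cmod_mult, Cmod_R, Rabs_pos_eq by lra.
    pose proof (Cmod_ge_0 w). nra. }
  assert (Hmv : Cmod (phi 1 - phi 0) <= 2 * (M * Cmod w ^ 5)).
  { apply mean_value_bound with
      (dphi := fun t : R => (- w * (t * w) ^ 4 * (e + 4 * Q 4%nat * (t * w))
         * / ((1 - t * w) * (1 + t * w)) * E t)%C).
    - intros t Ht. specialize (Hu t Ht).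
      destruct (cayley_bounds (t * w)%C ltac:(lra)) as [Hp [Hm [Hre Hz]]].
      assert (Hn1 : (1 - t * w)%C <> 0) by (apply Cmod_gt_0; lra).
      assert (Hn2 : (1 + t * w)%C <> 0) by (apply Cmod_gt_0; lra).
      assert (Hplus : has_derivative (fun s => 1 + s * w)%C t w).
      { eapply has_derivative_eq.
        - apply has_derivative_plus; [apply has_derivative_const|apply has_derivative_line].
        - cbv beta. ring. }
      assert (Hminus : has_derivative (fun s => 1 - s * w)%C t (- w)%C).
      { eapply has_derivative_eq.
        - apply (has_derivative_plus (fun _ => 1) (fun s => - (s * w))%C);
            [apply has_derivative_const|].
          destruct (has_derivative_line (- w)%C t) as [D1 D2].
          split; [apply (is_derive_ext (fun s : R => Re (s * - w)%C))
                 |apply (is_derive_ext (fun s : R => Im (s * - w)%C))]; [| exact D1| |exact D2];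
            intros s; f_equal; ring.
        - cbv beta. ring. }
      assert (Hzeta : has_derivative zeta t (2 * w / ((1 - t * w) * (1 - t * w)))%C).
      { eapply has_derivative_eq.
        - apply has_derivative_mult; [exact Hplus|].
          apply has_derivative_inv; [exact Hn1|exact Hminus].
        - cbv beta. field. auto. }
      assert (Hlog := has_derivative_half_plane_log zeta t _ Hre Hzeta).
      eapply has_derivative_eq.
      + apply has_derivative_mult; [apply has_derivative_taylor|].
        apply has_derivative_Cexp. apply has_derivative_mult;
          [apply has_derivative_const|exact Hlog].
      + cbv beta. fold (E t). generalize (E t) (half_plane_log (zeta t)).
        intros x y. unfold zeta, e, Q, majorant_jet. simpl taylor.
        rewrite ?RtoC_plus. field. auto.
    - intros t Ht. specialize (Hu t Ht).
      destruct (cayley_bounds (t * w)%C ltac:(lra)) as [Hp [Hm [Hre Hz]]].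
      assert (Hn1 : (1 - t * w)%C <> 0) by (apply Cmod_gt_0; lra).
      assert (Hn2 : (1 + t * w)%C <> 0) by (apply Cmod_gt_0; lra).
      assert (HE : Cmod (E t) <= 3).
      { apply (Cmod_Cexp_log_le beta (-1) (zeta t)); auto. }
      set (u := (t * w)%C) in *.
      rewrite !Cmod_mult, Cmod_opp, Cmod_pow, Cmod_inv, Cmod_mult
        by (apply Cmult_neq_0; auto).
      assert (HI : / (Cmod (1 - u) * Cmod (1 + u)) <= 4).
      { replace 4 with (/ (1 / 2 * (1 / 2))) by field.
        apply Rinv_le_contravar; [lra|]. apply Rmult_le_compat; lra. }
      assert (HI0 : 0 < / (Cmod (1 - u) * Cmod (1 + u))).
      { apply Rinv_0_lt_compat, Rmult_lt_0_compat; lra. }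
      assert (Hpoly : Cmod (e + 4 * Q 4%nat * u) <= Cmod e + Cmod (4 * Q 4%nat)).
      { apply Rle_trans with (1 := Cmod_triangle _ _). apply Rplus_le_compat_l.
        rewrite Cmod_mult. pose proof (Cmod_ge_0 (4 * Q 4%nat)). nra. }
      assert (H4 : Cmod u ^ 4 <= Cmod w ^ 4).
      { apply pow_incr. split; [apply Cmod_ge_0|auto]. }
      apply Rle_trans with (Cmod w * Cmod w ^ 4 * (Cmod e + Cmod (4 * Q 4%nat)) * 4 * 3).
      + repeat apply Rmult_le_compat; auto;
          repeat apply Rmult_le_pos; try apply pow_le; try apply Cmod_ge_0; try lra.
      + right. unfold M. ring. }
  assert (H0 : phi 0 = 1).
  { unfold phi. rewrite Cmult_0_l, taylor_at_0.
    unfold E, zeta. rewrite Cmult_0_l.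
    replace ((1 + 0) * / (1 - 0))%C with (RtoC 1) by field.
    unfold half_plane_log, Re, Im. simpl.
    replace (1 * (1 * 1) + 0 * (0 * 1)) with 1 by ring.
    rewrite ln_1. replace (0 / 1) with 0 by field. rewrite atan_0.
    replace (0 / 2) with 0 by field.
    unfold Q, majorant_jet, Cexp, Re, Im, Cmult, RtoC. simpl.
    rewrite ?Rmult_0_r, ?Rminus_0_r, ?Rplus_0_r. rewrite exp_0, cos_0, sin_0.
    f_equal; ring. }
  destruct (cayley_bounds w ltac:(lra)) as [Hp [Hm [Hre Hz]]].
  set (G := strongly_starlike_majorant beta w).
  assert (HG : G = Cexp (1 * beta * half_plane_log ((1 + w) / (1 - w)))%C).
  { unfold G, strongly_starlike_majorant, Cpower. rewrite Clog_half_plane by auto.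
    f_equal. ring. }
  assert (HG3 : Cmod G <= 3).
  { rewrite HG. apply Cmod_Cexp_log_le; auto. }
  assert (H1 : (phi 1 * G = taylor Q 4 w)%C).
  { unfold phi. rewrite Cmult_1_l. rewrite HG. unfold E, zeta. rewrite Cmult_1_l.
    fold ((1 + w) / (1 - w))%C. set (L := half_plane_log ((1 + w) / (1 - w))%C).
    replace (-1 * beta * L)%C with (- (1 * beta * L))%C by ring.
    rewrite <- Cmult_assoc, Cexp_opp. ring. }
  rewrite H0 in Hmv. fold G. rewrite <- H1.
  replace (G - phi 1 * G)%C with (- ((phi 1 - 1) * G))%C by ring.
  rewrite Cmod_opp, Cmod_mult.
  pose proof (Cmod_ge_0 (phi 1 - 1)). pose proof (Cmod_ge_0 G). nra.
Qed.

(** * The extremal problem for the fifth coefficient *)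

Lemma Cmod_quadratic_sqr (s z : C) (A B D : R) :
  Cmod (A * z ^ 2 + B * s * z + D * s ^ 2) ^ 2 =
  A ^ 2 * (Cmod z ^ 2) ^ 2 + B ^ 2 * Cmod s ^ 2 * Cmod z ^ 2 + D ^ 2 * (Cmod s ^ 2) ^ 2
  + 2 * A * B * Cmod z ^ 2 * Re (z * Cconj s) + 2 * B * D * Cmod s ^ 2 * Re (z * Cconj s)
  + 2 * A * D * (2 * Re (z * Cconj s) ^ 2 - Cmod z ^ 2 * Cmod s ^ 2).
Proof.
  rewrite !Cmod2_alt. destruct s as [a b], z as [x y].
  unfold Re, Im, Cconj, Cplus, Cmult, RtoC. simpl. ring.
Qed.

(** As [z] turns away from the direction of [s], the modulus drops from its value in the
    aligned case by at least [k] times the drop of [Re (z * conj s)]. After squaring and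
    dividing by [d = |s| |z| - Re (z * conj s)] the claim is affine in [d] on
    [0 <= d <= 2 |s| |z|], and the numerical hypotheses settle the two endpoints. *)
Lemma Cmod_quadratic_le (s z : C) (A B D k : R) :
  0 <= A -> 0 <= D -> 0 <= k <= B -> k ^ 2 <= 4 * A * D -> k * B <= 4 * A * D ->
  Cmod (A * z ^ 2 + B * s * z + D * s ^ 2)
  <= A * Cmod z ^ 2 + (B - k) * Cmod s * Cmod z + D * Cmod s ^ 2
     + k * Re (z * Cconj s).
Proof.
  intros HA HD Hk Hk2 HkB.
  assert (E := Cmod_quadratic_sqr s z A B D).
  set (Y := Cmod (A * z ^ 2 + B * s * z + D * s ^ 2)) in *.
  set (X := Re (z * Cconj s)) in *.
  assert (HX : Rabs X <= Cmod z * Cmod s).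
  { rewrite <- (Cmod_conj s), <- Cmod_mult. apply re_le_Cmod. }
  apply Rabs_le_between in HX.
  assert (HY : 0 <= Y) by apply Cmod_ge_0.
  generalize dependent (Cmod z). intros r E HX.
  generalize dependent (Cmod s). intros S E HX.
  clearbody X Y.
  set (P := S * r).
  assert (HP : 0 <= P) by (unfold P; lra).
  set (d := P - X). assert (Hd : 0 <= d <= 2 * P) by (unfold d, P; lra).
  set (V := A * r ^ 2 + D * S ^ 2).
  (* arithmetic-geometric mean: V >= 2 sqrt (A D) r S >= k r S *)
  assert (HV : k * P <= V).
  { assert (HV0 : 0 <= V) by (unfold V; pose proof (pow2_ge_0 r);
      pose proof (pow2_ge_0 S); nra).
    assert (HV2 : (k * P) ^ 2 <= V ^ 2).
    { apply Rle_trans with (4 * A * D * P ^ 2).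
      - rewrite Rpow_mult_distr. apply Rmult_le_compat_r; [apply pow2_ge_0|auto].
      - unfold V, P. pose proof (pow2_ge_0 (A * r ^ 2 - D * S ^ 2)). nra. }
    apply Rnot_lt_le. intros Hlt. nra. }
  assert (HR : 0 <= V + B * P - k * d) by nra.
  assert (E1 : A * r ^ 2 + (B - k) * S * r + D * S ^ 2 + k * X = V + B * P - k * d).
  { unfold V, d, P. ring. }
  rewrite E1.
  assert (Hsq : Y ^ 2 <= (V + B * P - k * d) ^ 2).
  { set (b0 := 2 * (B - k) * V + 2 * (4 * A * D - k * B) * P).
    set (b1 := 2 * (B - k) * (V - k * P)).
    assert (Hb0 : 0 <= b0).
    { unfold b0. assert (0 <= (B - k) * V) by (apply Rmult_le_pos; nra).
      assert (0 <= (4 * A * D - k * B) * P) by (apply Rmult_le_pos; lra). lra. }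
    assert (Hb1 : 0 <= b1).
    { unfold b1. assert (0 <= (B - k) * (V - k * P)) by (apply Rmult_le_pos; lra). lra. }
    assert (E2 : 2 * P * ((V + B * P - k * d) ^ 2 - Y ^ 2)
      = d * ((2 * P - d) * b0 + d * b1)).
    { rewrite E. unfold b0, b1, V. replace X with (P - d) by (unfold d; ring).
      clearbody d. unfold P. ring. }
    destruct (Rle_lt_or_eq_dec 0 P HP) as [HP1|HP1].
    - assert (0 <= d * ((2 * P - d) * b0 + d * b1)).
      { apply Rmult_le_pos; [lra|].
        assert (0 <= (2 * P - d) * b0) by (apply Rmult_le_pos; lra).
        assert (0 <= d * b1) by (apply Rmult_le_pos; lra). lra. }
      nra.
    - assert (Hd0 : d = 0) by lra.
      assert (HX0 : X = 0) by (unfold d in Hd0; lra).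
      rewrite E, Hd0, HX0, <- HP1. unfold V.
      assert (Hrs : S * r = 0) by (unfold P in HP1; lra).
      right. transitivity ((A * r ^ 2 + D * S ^ 2) ^ 2
        + (B ^ 2 - 4 * A * D) * (S * r) ^ 2); [ring|rewrite Hrs; ring]. }
  apply Rnot_lt_le. intros Hlt. nra.
Qed.

(** [2 / beta] times the fifth coefficient of the normalised [f] with
    [z f' / f = ((1 + w) / (1 - w))^beta], where [w = p z + p2 z^2 + p3 z^3 + p4 z^4 + ...]. *)
Definition fifth_coefficient_functional (beta : R) (p p2 p3 p4 : C) : C :=
  (p4 + 14 / 3 * beta * p * p3 + 2 * beta * p2 ^ 2
   + (40 / 3 * beta ^ 2 + 1) * p ^ 2 * p2
   + (76 * beta ^ 3 + 14 * beta) / 9 * p ^ 4)%C.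

(** The part of the functional that is linear in [p3], [p4] is absorbed by the Schwarz
    inequality with [al = (7/3) beta p]. The bound that remains is largest when
    [p2] is a positive multiple of [p^2] with [|p2| = 1 - |p|^2], and the resulting
    function of [|p|^2] increases up to the endpoint [1 / (1 + beta)]. *)
Lemma fifth_coefficient_functional_le (beta : R) (p p2 p3 p4 : C) :
  1 / 2 <= beta <= 1 ->
  Cmod p2 <= 1 - Cmod p ^ 2 ->
  (1 + beta) * Cmod p ^ 2 <= 1 ->
  (forall al : C, Cmod (p4 + 2 * al * p3 + al ^ 2 * p2)
     <= 1 + Cmod al ^ 2 - Cmod p ^ 2 - Cmod (p2 + al * p) ^ 2) ->
  Cmod (fifth_coefficient_functional beta p p2 p3 p4)
  <= beta * (214 * beta ^ 2 - 42 * beta + 32) / (9 * (1 + beta) ^ 2).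
Proof.
  intros Hb Hp2 Hp Hal.
  set (T := Cmod p ^ 2) in *. assert (HT : 0 <= T) by apply pow2_ge_0.
  set (rho := Cmod p2) in *. assert (Hrho : 0 <= rho) by apply Cmod_ge_0.
  set (X := Re (p2 * Cconj (p ^ 2))).
  set (D := 71 / 9 * beta ^ 2 + 1). set (eta := (76 * beta ^ 3 + 14 * beta) / 9).
  set (k := 14 / 3 * beta).
  set (al := (7 / 3 * beta * p)%C).
  assert (HalT : Cmod al ^ 2 = 49 / 9 * beta ^ 2 * T).
  { unfold al, T. rewrite !Cmod2_alt. destruct p as [x y].
    unfold Re, Im, Cdiv, Cinv, Cmult, RtoC. simpl. field. }
  assert (Hd1 : Cmod (p2 + al * p) ^ 2
    = rho ^ 2 + k * X + 49 / 9 * beta ^ 2 * T ^ 2).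
  { unfold al, T, rho, X, k. rewrite !Cmod2_alt. destruct p as [x y], p2 as [u v].
    unfold Re, Im, Cconj, Cdiv, Cinv, Cmult, Cplus, RtoC. simpl. field. }
  assert (Hs : Cmod (p ^ 2) = T) by (unfold T; apply Cmod_pow).
  assert (HY : Cmod (RtoC (2 * beta) * p2 ^ 2 + RtoC D * p ^ 2 * p2
      + RtoC eta * (p ^ 2) ^ 2)
    <= 2 * beta * rho ^ 2 + (D - k) * T * rho + eta * T ^ 2 + k * X).
  { unfold rho, X. rewrite <- Hs. apply Cmod_quadratic_le.
    - lra.
    - unfold eta. nra.
    - unfold k, D. split; nra.
    - apply Rminus_le_0. unfold k, eta.
      replace (4 * (2 * beta) * ((76 * beta ^ 3 + 14 * beta) / 9) - (14 / 3 * beta) ^ 2)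
        with (beta ^ 2 * (608 * beta ^ 2 - 84) / 9) by field.
      apply Rmult_le_pos; [|lra]. apply Rmult_le_pos; nra.
    - apply Rminus_le_0. unfold k, D, eta.
      replace (4 * (2 * beta) * ((76 * beta ^ 3 + 14 * beta) / 9)
          - 14 / 3 * beta * (71 / 9 * beta ^ 2 + 1))
        with (beta * (beta ^ 2 * (1824 * beta - 994) + 336 * beta - 126) / 27) by field.
      assert (1824 * beta - 994 >= -82) by lra.
      assert (- (82 * beta ^ 2) <= beta ^ 2 * (1824 * beta - 994))
        by (pose proof (pow2_ge_0 beta); nra).
      apply Rmult_le_pos; [|lra]. apply Rmult_le_pos; nra. }
  assert (Hsplit : fifth_coefficient_functional beta p p2 p3 p4
    = ((p4 + 2 * al * p3 + al ^ 2 * p2)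
       + (RtoC (2 * beta) * p2 ^ 2 + RtoC D * p ^ 2 * p2 + RtoC eta * (p ^ 2) ^ 2))%C).
  { unfold fifth_coefficient_functional, al, D, eta.
    rewrite ?RtoC_div, ?RtoC_plus, ?RtoC_mult, ?RtoC_div, ?RtoC_pow by lra. field. }
  rewrite Hsplit. apply Rle_trans with (1 := Cmod_triangle _ _).
  specialize (Hal al). rewrite HalT, Hd1 in Hal.
  set (m := 1 - T) in *.
  set (H := fun t => (1 - t) + 49 / 9 * beta ^ 2 * t * (1 - t)
    + (2 * beta - 1) * (1 - t) ^ 2 + (D - k) * t * (1 - t) + eta * t ^ 2).
  apply Rle_trans with (H T).
  - assert (Hr2 : (2 * beta - 1) * rho ^ 2 <= (2 * beta - 1) * m ^ 2).
    { apply Rmult_le_compat_l; [lra|]. apply pow_incr. lra. }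
    assert (HDk : 0 <= D - k) by (unfold D, k; nra).
    assert (Hr1 : (D - k) * T * rho <= (D - k) * T * m).
    { apply Rmult_le_compat_l; [apply Rmult_le_pos; lra|auto]. }
    unfold H. unfold m in *. nra.
  - set (T0 := 1 / (1 + beta)).
    assert (HT0 : T <= T0).
    { unfold T0. apply Rmult_le_reg_l with (1 + beta); [lra|].
      replace ((1 + beta) * (1 / (1 + beta))) with 1 by (field; lra). auto. }
    assert (HE : H T0 = beta * (214 * beta ^ 2 - 42 * beta + 32) / (9 * (1 + beta) ^ 2)).
    { unfold H, T0, D, k, eta. field. lra. }
    rewrite <- HE.
    set (h1 := 40 / 3 * beta ^ 2 - 26 / 3 * beta + 2).
    set (h2 := (76 * beta ^ 3 + 14 * beta) / 9 - 40 / 3 * beta ^ 2 + 20 / 3 * beta - 2).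
    assert (Hdiff : H T0 - H T = (T0 - T) * (h1 + h2 * (T0 + T))).
    { unfold H, D, k, eta, h1, h2. clearbody T0. field. }
    assert (Hh1 : 0 <= h1) by (unfold h1; nra).
    assert (Hh2 : 0 <= h1 + 2 * h2 * T0).
    { apply Rmult_le_reg_l with (1 + beta); [lra|]. rewrite Rmult_0_r.
      replace ((1 + beta) * (h1 + 2 * h2 * T0)) with ((1 + beta) * h1 + 2 * h2)
        by (unfold T0; field; lra).
      replace ((1 + beta) * h1 + 2 * h2)
        with (7 / 6 + (beta - 1 / 2) * (94 / 9 + 70 / 3 * (beta - 1 / 2)
          + 272 / 9 * (beta - 1 / 2) ^ 2)) by (unfold h1, h2; field).
      assert (0 <= beta - 1 / 2) by lra. nra. }
    assert (HT0p : 0 < T0) by (unfold T0; apply Rdiv_lt_0_compat; lra).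
    assert (Hlin : 0 <= h1 + h2 * (T0 + T)).
    (* affine in T, and nonnegative both at T0 and at - T0 *)
    { nra. }
    assert (0 <= (T0 - T) * (h1 + h2 * (T0 + T))) by (apply Rmult_le_pos; lra).
    lra.
Qed.

Lemma target_bound (beta : R) :
  1 / 2 <= beta <= 1 ->
  beta / 2 * (beta * (214 * beta ^ 2 - 42 * beta + 32) / (9 * (1 + beta) ^ 2)) <=
    beta / 9 *
      (30 * beta ^ 2 - 21 * beta + 9
       + (38 * beta ^ 2 - 30 * beta + 7) * beta / (beta + 1) ^ 4
       + 3 * (7 * beta - 3) / sqrt (beta + 1)).
Proof.
  intros Hb.
  (* the tangent to the convex function 1 / sqrt at the point 25 / 16 *)
  assert (Hs : (118 - 32 * beta) / 125 <= / sqrt (beta + 1)).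
  { set (s := sqrt (beta + 1)).
    assert (Hs0 : 0 < s) by (apply sqrt_lt_R0; lra).
    assert (Hss : s * s = beta + 1) by (apply sqrt_sqrt; lra).
    apply Rmult_le_reg_r with s; [auto|]. rewrite Rinv_l by lra.
    replace beta with (s * s - 1) by lra.
    pose proof (pow2_ge_0 (s - 5 / 4)). nra. }
  set (c := 30 * beta ^ 2 - 21 * beta + 9
    + (38 * beta ^ 2 - 30 * beta + 7) * beta / (beta + 1) ^ 4).
  replace (beta / 2 * (beta * (214 * beta ^ 2 - 42 * beta + 32) / (9 * (1 + beta) ^ 2)))
    with (beta / 9 * (beta * (107 * beta ^ 2 - 21 * beta + 16) / (beta + 1) ^ 2))
    by (field; lra).
  apply Rmult_le_compat_l; [lra|].
  apply Rle_trans with (c + 3 * (7 * beta - 3) * ((118 - 32 * beta) / 125)).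
  - apply Rmult_le_reg_r with ((beta + 1) ^ 4); [apply pow_lt; lra|].
    apply Rminus_le_0. unfold c.
    match goal with |- 0 <= ?e => replace e with
      ((30 * beta ^ 2 - 21 * beta + 9 + 3 * (7 * beta - 3) * ((118 - 32 * beta) / 125))
         * (beta + 1) ^ 4
       + (38 * beta ^ 2 - 30 * beta + 7) * beta
       - beta * (107 * beta ^ 2 - 21 * beta + 16) * (beta + 1) ^ 2) by (field; lra) end.
    set (x := beta - 1 / 2). assert (Hx : 0 <= x) by (unfold x; lra).
    replace beta with (x + 1 / 2) by (unfold x; ring). clearbody x.
    ring_simplify.
    pose proof (pow_le x 2 Hx). pose proof (pow_le x 3 Hx). pose proof (pow_le x 4 Hx).
    pose proof (pow_le x 5 Hx). pose proof (pow_le x 6 Hx). lra.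
  - apply Rplus_le_compat_l. unfold Rdiv at 2. apply Rmult_le_compat_l; lra.
Qed.

(** * Coefficients of strongly bi-starlike functions *)

Fixpoint pow_coef (c : nat -> C) (j : nat) : nat -> C :=
  match j with
  | O => fun k => match k with O => RtoC 1 | _ => RtoC 0 end
  | S i => conv c (pow_coef c i)
  end.

Fixpoint comp_coef (g c : nat -> C) (m : nat) (k : nat) : C :=
  match m with
  | O => (g O * pow_coef c O k)%C
  | S i => (comp_coef g c i k + g m * pow_coef c m k)%C
  end.

Lemma jet_pow (n : nat) (w : C -> C) (c : nat -> C) (j : nat) :
  jet n w c -> jet n (fun z => w z ^ j)%C (pow_coef c j).
Proof.
  intros H. induction j as [|j IH].
  - apply (jet_const n 1).
  - apply (jet_mult n w (fun z => w z ^ j)%C); auto.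
Qed.

Lemma jet_comp (n : nat) (G w : C -> C) (g c : nat -> C) :
  jet n G g -> jet n w c -> c O = 0 -> jet n (fun z => G (w z)) (comp_coef g c n).
Proof.
  intros HG Hw Hc.
  assert (Hw1 : big_O 1 w).
  { apply big_O_ext with (fun u => w u - taylor c 0 u)%C.
    - intros u. simpl. rewrite Hc. ring.
    - apply (jet_le 0 n); [lia|auto]. }
  apply jet_of_big_O with (fun z => taylor g n (w z)).
  - assert (H := big_O_comp 0 (S n) _ _ HG Hw1). rewrite Nat.mul_1_l in H. exact H.
  - assert (Hall : forall m, jet n (fun z => taylor g m (w z)) (comp_coef g c m)).
    { induction m as [|m IH].
      - apply jet_fun_ext with (fun z => g O * w z ^ 0)%C; [intros; simpl; ring|].
        apply (jet_scal n (g O) (fun z => w z ^ 0)%C), jet_pow, Hw.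
      - apply (jet_plus n (fun z => taylor g m (w z)) (fun z => g (S m) * w z ^ S m)%C);
          [exact IH|]. apply (jet_scal n (g (S m)) (fun z => w z ^ S m)%C), jet_pow, Hw. }
    apply Hall.
Qed.

(** Comparing coefficients in [f'(z) = (f(z) / z) * ((1 + w(z)) / (1 - w(z)))^beta];
    dividing by [z] first keeps both sides at order four. *)
Lemma starlike_recurrence (f w : C -> C) (A c : nat -> C) (beta : R) :
  0 <= beta <= 1 -> univalent_on_disc f ->
  (forall n, jet n f A) -> A O = 0 -> A 1%nat = 1 ->
  schwarz w -> (forall n, jet n w c) ->
  (forall z, Cmod z < 1 -> starlike_quotient f z = strongly_starlike_majorant beta (w z)) ->
  forall k, (k <= 4)%nat ->
    conv (fun i => A (S i)) (comp_coef (majorant_jet beta) c 4) k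
    = (INR (S k) * A (S k))%C.
Proof.
  intros Hb [Hfa Hfi] HA HA0 HA1 [Hwa [Hw0 Hw1]] Hc Hq.
  assert (Hf0 : f 0 = 0) by (rewrite (jet_value _ _ _ (HA O)); auto).
  set (f1 := fun z => if Ceq_dec z 0 then RtoC 1 else (f z / z)%C).
  assert (Hf1 : jet 4 f1 (fun i => A (S i))).
  { apply (jet_div_pow 1 4 f f1 A); [apply HA| | |].
    - intros k Hk. replace k with O by lia. auto.
    - unfold f1. destruct (Ceq_dec 0 0) as [_|N]; [auto|now destruct N].
    - intros u Hu. unfold f1. destruct (Ceq_dec u 0) as [E|_]; [now destruct Hu|].
      field. auto. }
  assert (Hmaj : jet 4 (fun z => strongly_starlike_majorant beta (w z))
    (comp_coef (majorant_jet beta) c 4)).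
  { apply jet_comp; [apply jet_majorant; auto|apply Hc|].
    rewrite <- (jet_value _ _ _ (Hc O)). auto. }
  assert (Hprod := jet_mult 4 _ _ _ _ Hf1 Hmaj).
  apply (jet_unique 4 (C_derive f)).
  - apply (jet_near 4 _ _ _ 1 ltac:(lra)) with (2 := Hprod).
    intros z Hz. rewrite <- Hq by auto. unfold starlike_quotient, f1.
    destruct (Ceq_dec z 0) as [->|Hz0].
    + rewrite Cmult_1_l. rewrite (jet_C_derive_value f 0 A); [auto|].
      apply jet_fun_ext with (2 := HA 1%nat). intros u. now rewrite Cplus_0_l.
    + assert (Hfz : f z <> 0).
      { intros E. apply Hz0. apply Hfi; auto; [rewrite Cmod_0; lra|].
        now rewrite Hf0. }
      field. auto.
  - apply jet_C_derive; auto.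
Qed.

Lemma starlike_coefficients (f w : C -> C) (A c : nat -> C) (beta : R) :
  0 <= beta <= 1 -> univalent_on_disc f ->
  (forall n, jet n f A) -> A O = 0 -> A 1%nat = 1 ->
  schwarz w -> (forall n, jet n w c) ->
  (forall z, Cmod z < 1 -> starlike_quotient f z = strongly_starlike_majorant beta (w z)) ->
  (A 2%nat = 2 * beta * c 1%nat
   /\ A 3%nat = 3 * beta ^ 2 * c 1%nat ^ 2 + beta * c 2%nat
   /\ A 5%nat = beta / 2 * fifth_coefficient_functional beta
        (c 1%nat) (c 2%nat) (c 3%nat) (c 4%nat))%C.
Proof.
  intros Hb Hf HA HA0 HA1 Hw Hc Hq.
  assert (Hc0 : c O = 0).
  { rewrite <- (jet_value _ _ _ (Hc O)). apply Hw. }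
  assert (Hrec := starlike_recurrence f w A c beta Hb Hf HA HA0 HA1 Hw Hc Hq).
  assert (R1 := Hrec 1%nat ltac:(lia)). assert (R2 := Hrec 2%nat ltac:(lia)).
  assert (R3 := Hrec 3%nat ltac:(lia)). assert (R4 := Hrec 4%nat ltac:(lia)).
  clear Hrec.
  cbn [conv comp_coef pow_coef majorant_jet] in R1, R2, R3, R4.
  rewrite HA1, Hc0 in R1, R2, R3, R4.
  cbn [INR] in R1, R2, R3, R4.
  repeat rewrite RtoC_plus in R1. repeat rewrite RtoC_plus in R2.
  repeat rewrite RtoC_plus in R3. repeat rewrite RtoC_plus in R4.
  assert (E2 : A 2%nat = (2 * beta * c 1%nat)%C).
  { transitivity ((1 + 1) * A 2%nat - A 2%nat)%C; [ring|]. rewrite <- R1. ring. }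
  rewrite E2 in R2, R3, R4.
  assert (E3 : A 3%nat = (3 * beta ^ 2 * c 1%nat ^ 2 + beta * c 2%nat)%C).
  { transitivity (/ 2 * ((1 + 1 + 1) * A 3%nat - A 3%nat))%C; [field|].
    rewrite <- R2. field. }
  rewrite E3 in R3, R4.
  assert (E4 : A 4%nat = (/ 3 * ((1 + 1 + 1 + 1) * A 4%nat - A 4%nat))%C) by field.
  rewrite <- R3 in E4.
  rewrite E4 in R4.
  split; [exact E2|]. split; [exact E3|].
  transitivity (/ 4 * ((1 + 1 + 1 + 1 + 1) * A 5%nat - A 5%nat))%C; [field|].
  rewrite <- R4. unfold fifth_coefficient_functional. field.
Qed.

(** The inverse function contributes one relation: its Schwarz function starts with
    [- c1] and [2 beta c1^2 - c2], so that the bound on second coefficients, applied to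
    both Schwarz functions, limits [|c1|]. *)
Lemma bi_starlike_c1_bound (f g w v : C -> C) (A c q : nat -> C) (beta : R) :
  0 < beta <= 1 -> univalent_on_disc f -> univalent_inverse_continuation f g ->
  (forall n, jet n f A) -> A O = 0 -> A 1%nat = 1 ->
  schwarz w -> (forall n, jet n w c) -> schwarz v -> (forall n, jet n v q) ->
  (forall z, Cmod z < 1 -> starlike_quotient f z = strongly_starlike_majorant beta (w z)) ->
  (forall z, Cmod z < 1 -> starlike_quotient g z = strongly_starlike_majorant beta (v z)) ->
  (1 + beta) * Cmod (c 1%nat) ^ 2 <= 1.
Proof.
  intros Hb Hf [Hg [r [Hr Hinv]]] HA HA0 HA1 Hw Hc Hv Hq Hqf Hqg.
  assert (Hf0 : f 0 = 0) by (rewrite (jet_value _ _ _ (HA O)); auto).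
  assert (Hg0 : g 0 = 0).
  { destruct (Hinv 0) as [H1 H2]; [rewrite Cmod_0; auto|].
    apply Hf; [auto|rewrite Cmod_0; lra|]. now rewrite H2, Hf0. }
  destruct (analytic_jet_at_0 g (proj1 Hg)) as [b Hbj].
  assert (Hb0 : b O = 0) by (rewrite <- (jet_value _ _ _ (Hbj O)); auto).
  assert (Hcomp : forall k, (k <= 3)%nat -> comp_coef A b 3 k =
    match k with 1%nat => RtoC 1 | _ => RtoC 0 end).
  { apply (jet_unique 3 (fun z => z)); [|apply jet_id].
    apply (jet_near 3 _ _ _ r Hr (fun z Hz => proj2 (Hinv z Hz))).
    apply jet_comp; auto. }
  assert (R1 := Hcomp 1%nat ltac:(lia)). assert (R2 := Hcomp 2%nat ltac:(lia)).
  assert (R3 := Hcomp 3%nat ltac:(lia)).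
  cbn [conv comp_coef pow_coef] in R1, R2, R3. rewrite HA0, HA1, Hb0 in R1, R2, R3.
  assert (B1 : b 1%nat = 1) by (rewrite <- R1; ring).
  rewrite B1 in R2, R3.
  assert (B2 : b 2%nat = (- A 2%nat)%C).
  { transitivity (0 - A 2%nat)%C; [rewrite <- R2; ring|ring]. }
  rewrite B2 in R3.
  assert (B3 : b 3%nat = (2 * A 2%nat ^ 2 - A 3%nat)%C).
  { transitivity (0 + 2 * A 2%nat ^ 2 - A 3%nat)%C; [rewrite <- R3; ring|ring]. }
  destruct (starlike_coefficients f w A c beta ltac:(lra) Hf HA HA0 HA1 Hw Hc Hqf)
    as [FA2 [FA3 _]].
  destruct (starlike_coefficients g v b q beta ltac:(lra) Hg Hbj Hb0 B1 Hv Hq Hqg)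
    as [GA2 [GA3 _]].
  assert (Hbeta : RtoC beta <> 0).
  { apply Cmod_gt_0. rewrite Cmod_R, Rabs_pos_eq; lra. }
  assert (Q1 : q 1%nat = (- c 1%nat)%C).
  { transitivity (/ (2 * beta) * b 2%nat)%C; [rewrite GA2; field; auto|].
    rewrite B2, FA2. field. auto. }
  assert (Q2 : (c 2%nat + q 2%nat = RtoC (2 * beta) * c 1%nat ^ 2)%C).
  { transitivity (c 2%nat + / beta * (b 3%nat - 3 * beta ^ 2 * q 1%nat ^ 2))%C;
      [rewrite GA3; field; auto|].
    rewrite B3, Q1, FA2, FA3, RtoC_mult. field. auto. }
  assert (H1 := schwarz_c2_le w c Hw Hc). assert (H2 := schwarz_c2_le v q Hv Hq).
  rewrite Q1, Cmod_opp in H2.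
  assert (H3 := Cmod_triangle (c 2%nat) (q 2%nat)).
  rewrite Q2, Cmod_mult, Cmod_pow, Cmod_R, Rabs_pos_eq in H3 by lra. lra.
Qed.

Lemma jet_of_normalized_series (f : C -> C) (a : nat -> C) (n : nat) :
  (forall z : C, Cmod z < 1 ->
    @is_series C_AbsRing C_NormedModule
      (fun n : nat => (a (n + 2)%nat * z ^ (n + 2))%C) (f z - z)%C) ->
  jet n f (fun k => match k with O => RtoC 0 | 1%nat => RtoC 1 | _ => a k end).
Proof.
  intros ha.
  set (c := fun k => match k with O => RtoC 0 | 1%nat => RtoC 0 | _ => a k end).
  assert (Hc : jet n (fun z => f z - z)%C c).
  { apply series_jet with 1; [lra|]. intros u Hu.
    assert (Hzero : forall l : C, plus l (opp (RtoC 0 : C)) = l).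
    { intros l. change (l + - 0 = l)%C. ring. }
    apply is_series_decr_1. simpl c. rewrite Cmult_0_l, Hzero.
    apply is_series_decr_1. simpl c. rewrite Cmult_0_l, Hzero.
    apply is_series_ext with (2 := ha u Hu). intros k.
    replace (k + 2)%nat with (S (S k)) by lia. reflexivity. }
  apply jet_fun_ext with (fun z => (f z - z) + z)%C; [intros; ring|].
  eapply jet_ext; [|apply jet_plus; [exact Hc|apply jet_id]].
  intros [|[|k]] _; simpl; ring.
Qed.

Theorem theorem3p3 (beta : R) (f : C -> C) (a : nat -> C)
  (hbeta : 1 / 2 <= beta <= 1)
  (hf : SS_sigma beta f)
  (ha : forall z : C, Cmod z < 1 ->
    @is_series C_AbsRing C_NormedModule
      (fun n : nat => (a (n + 2)%nat * z ^ (n + 2))%C) (f z - z)%C) :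
  Cmod (a 5%nat) <=
    beta / 9 *
      (30 * beta ^ 2 - 21 * beta + 9
       + (38 * beta ^ 2 - 30 * beta + 7) * beta / (beta + 1) ^ 4
       + 3 * (7 * beta - 3) / sqrt (beta + 1)).
Proof.
  destruct hf as [[_ [Hf _]] [g [Hg [[w [Hwa [Hw0 Hw]]] [v [Hva [Hv0 Hv]]]]]]].
  assert (Sw : schwarz w) by (split; [auto|split; [auto|apply Hw]]).
  assert (Sv : schwarz v) by (split; [auto|split; [auto|apply Hv]]).
  destruct (analytic_jet_at_0 w Hwa) as [c Hc].
  destruct (analytic_jet_at_0 v Hva) as [q Hq].
  set (A := fun k => match k with O => RtoC 0 | 1%nat => RtoC 1 | _ => a k end).
  assert (HA : forall n, jet n f A) by (intros n; apply jet_of_normalized_series, ha).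
  destruct (starlike_coefficients f w A c beta ltac:(lra) Hf HA eq_refl eq_refl Sw Hc)
    as [_ [_ E5]]; [intros z Hz; apply (Hw z Hz)|].
  change (A 5%nat) with (a 5%nat) in E5.
  assert (H1 : (1 + beta) * Cmod (c 1%nat) ^ 2 <= 1).
  { apply (bi_starlike_c1_bound f g w v A c q beta); auto; try lra;
      intros z Hz; [apply (Hw z Hz)|apply (Hv z Hz)]. }
  rewrite E5.
  replace (beta / 2)%C with (RtoC (beta / 2)) by (apply RtoC_div; lra).
  rewrite Cmod_mult, Cmod_R, Rabs_pos_eq by lra.
  apply Rle_trans with (2 := target_bound beta hbeta).
  apply Rmult_le_compat_l; [lra|].
  apply fifth_coefficient_functional_le; auto.
  - apply (schwarz_c2_le w c Sw Hc).
  - intros al. apply (schwarz_c4_le w c al Sw Hc).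
Qed.
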